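(* Let $G$ be a finitely generated group with a finite symmetric generating set $S$, and suppose $G\curvearrowright (X,\mu)$ is a probability measure preserving and essentially free action on a standard probability measure space. If $\mathcal{I}_{(G,S)\curvearrowright X}(n)\to 0$ as $n\to\infty$, then $G$ is amenable. Further, the converse holds if the action is ergodic: if $G$ is amenable and the action is moreover ergodic, then $\mathcal{I}_{(G,S)\curvearrowright X}(n)\to 0$ as $n\to\infty$.
   Context: A generating set $S$ of $G$ is symmetric if $s\in S$ implies $s^{-1}\in S$. The action is essentially free if $\mu(\{x\in X: gx=x\})=0$ for every non-trivial $g\in G$. Let $\mathcal{R}\subset X\times X$ be the orbit equivalence relation of the action. A subequivalence relation of $\mathcal{R}$ is a subset of $\mathcal{R}$ that is itself an equivalence relation on $X$; all subequivalence relations are assumed measurable as subsets of $X\times X$. For such $\theta\subset\mathcal{R}$, $[x]_\theta$ is the class of $x$, $|\theta|$ is the maximal size of an equivalence class of $\theta$, and $$\partial\theta=\{x\in X : sx\notin [x]_\theta \text{ for some } s\in S\}.$$ The isoperimetric profile of the action is $$\mathcal{I}_{(G,S)\curvearrowright X}(n)=\inf\{\mu(\partial\theta) : \theta\subset\mathcal{R}\text{ a measurable subequivalence relation with } |\theta|\le n\}.$$ *)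

(* Defs.v *)
From HB Require Import structures.
From mathcomp Require Import all_boot all_order all_algebra.
From mathcomp Require Import all_classical all_reals all_analysis.

Set Implicit Arguments.
Unset Strict Implicit.
Unset Printing Implicit Defensive.

Import Order.TTheory GRing.Theory Num.Theory.
Import numFieldNormedType.Exports.

Local Open Scope classical_set_scope.
Local Open Scope ring_scope.

Definition is_subgroup (G : groupType) (H : set G) : Prop :=
  [/\ H 1%g,
      forall g h, H g -> H h -> H (g * h)%g &
      forall g, H g -> H (g^-1)%g].

Definition generates (G : groupType) (S : set G) : Prop :=
  smallest (@is_subgroup G) S = setT.

Definition symmetric_set (G : groupType) (S : set G) : Prop :=
  forall s, S s -> S (s^-1)%g.

(* Amenability of a discrete group in the sense of von Neumann. *)
Definition amenable (R : realType) (G : groupType) : Prop :=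
  exists m : set G -> R,
    [/\ forall A, 0 <= m A,
        m setT = 1,
        forall A B, A `&` B = set0 -> m (A `|` B) = m A + m B &
        forall g A, m [set (g * a)%g | a in A] = m A].

(* The sigma-algebra of [X] is the Borel sigma-algebra of a Polish topology,
   i.e. one induced by a separable complete metric.  The topology is carried by
   a copy [T] of [X], and "metric" is rendered as "pseudometric and
   Hausdorff". *)
Definition standard_borel (R : realType) d (X : measurableType d) : Prop :=
  exists (T : completePseudoMetricType R) (f : X -> T),
    [/\ hausdorff_space T,
        exists2 D : set T, countable D & dense D,
        bijective f &
        @measurable d X = [set f @^-1` B | B in <<s @open T >>]].

Section actions.
Context (R : realType) (d : measure_display) (X : measurableType d)
        (mu : probability X R) (G : groupType) (act : G -> X -> X).

Definition is_group_action : Prop :=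
  (forall x, act 1%g x = x) /\
  (forall g h x, act (g * h)%g x = act g (act h x)).

Definition measure_preserving : Prop :=
  forall g, measurable_fun setT (act g) /\
            (forall A, measurable A -> mu (act g @^-1` A) = mu A).

Definition essentially_free : Prop :=
  forall g, g <> 1%g -> mu [set x | act g x = x] = 0%E.

Definition ergodic : Prop :=
  forall A, measurable A -> (forall g, act g @^-1` A = A) ->
    mu A = 0%E \/ mu A = 1%E.

Definition orbit_rel : set (X * X) :=
  [set p | exists g, p.2 = act g p.1].

Definition rel_class (theta : set (X * X)) (x : X) : set X :=
  [set y | theta (x, y)].

Definition is_equivalence (theta : set (X * X)) : Prop :=
  [/\ forall x, theta (x, x),
      forall x y, theta (x, y) -> theta (y, x) &
      forall x y z, theta (x, y) -> theta (y, z) -> theta (x, z)].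

Definition subequivalence (theta : set (X * X)) : Prop :=
  [/\ measurable theta, theta `<=` orbit_rel & is_equivalence theta].

(* |theta| <= n *)
Definition classes_le (theta : set (X * X)) (n : nat) : Prop :=
  forall x, (rel_class theta x #<= `I_n)%card.

Definition boundary (S : set G) (theta : set (X * X)) : set X :=
  [set x | exists2 s, S s & ~ rel_class theta x (act s x)].

(* As an infimum in the extended reals, the value is +oo at n = 0, where no
   theta is admissible. *)
Definition isoperimetric_profile (S : set G) (n : nat) : \bar R :=
  ereal_inf [set mu (boundary S theta) | theta in
    [set theta | subequivalence theta /\ classes_le theta n]].

End actions.

(* Main.v *)
(* If the profile tends to 0, take for each k a relation theta_k with bounded
   classes and mu(boundary theta_k) < 1/k, and pick measurably (for a fixed Borel
   linear order on X) the least point g x of the class of x. By freeness g is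
   determined by x, and its law is a probability on G which is right
   S-invariant up to mu(boundary theta_k): indeed if s x is in the class of x,
   then x and s x select the same point. An ultralimit of these laws is a
   right-invariant mean, and inversion turns it into a left-invariant one.

   Conversely, Hall's theorem turns an invariant mean into Folner sets F. Given a
   measurable Y of positive measure and F sufficiently invariant, averaging over
   x shows that for a set of x of positive measure the finite set F x meets Y
   in a nonempty set with small boundary inside the graph induced on Y. By
   freeness one may thin this set of x out until the sets F x are disjoint, and
   use the sets F x inside Y as classes. Exhausting X in this way (Y being what is
   left over at each stage) gives a relation with finite classes and small
   boundary; cutting its large classes costs little. *)
Require Import Defs.
From HB Require Import structures.
From mathcomp Require Import all_boot all_order all_algebra finmap zify lra.
From mathcomp Require Import all_classical all_reals all_analysis.
From mathcomp Require Import measurable_realfun.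

Set Implicit Arguments.
Unset Strict Implicit.
Unset Printing Implicit Defensive.

Import Order.TTheory GRing.Theory Num.Theory.
Import numFieldNormedType.Exports.

Local Open Scope classical_set_scope.
Local Open Scope ring_scope.

(** * Hall's marriage theorem *)

Section hall.
Local Open Scope fset_scope.
Local Open Scope nat_scope.
Context {I T : choiceType}.
Implicit Types (A : I -> {fset T}) (J : {fset I}).

Definition hall_condition A :=
  forall J : {fset I}, #|` J| <= #|` \bigcup_(i <- J) A i|.

Definition updf A i0 (B : {fset T}) : I -> {fset T} :=
  fun i => if i == i0 then B else A i.

Let nbP A J t :
  reflect (exists2 i, i \in J & t \in A i) (t \in \bigcup_(i <- J) A i).
Proof.
apply: (iffP (bigfcupP J t A xpredT)) => [[i]|[i iJ ti]].
  by rewrite andbT; exists i.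
by exists i => //; rewrite iJ.
Qed.

(* Rado's lemma: if both deletions failed, submodularity of the size of the
   neighbourhood would contradict the Hall condition of [A]. *)
Lemma hall_condition_delete A i x y : hall_condition A ->
  x \in A i -> y \in A i -> x != y ->
  hall_condition (updf A i (A i `\ x)) \/ hall_condition (updf A i (A i `\ y)).
Proof.
move=> hA xA yA xy.
(* A deletion can only fail on a set containing [i]; dropping [i] from it leaves a [J] whose
   neighbourhood, even after adding the reduced [A i], is no larger than [J]. *)
have bad z : ~ hall_condition (updf A i (A i `\ z)) ->
    exists2 J : {fset I}, i \notin J &
      #|` (\bigcup_(j <- J) A j) `|` (A i `\ z)| <= #|` J|.
  move=> /existsNP [J /negP]; rewrite -ltnNge => JA.
  case: (boolP (i \in J)) => [iJ|iJ]; last first.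
    exfalso; move: JA; apply/negP; rewrite -leqNgt.
    apply: leq_trans (hA J) _; apply: fsubset_leq_card.
    apply/fsubsetP => t /nbP[j jJ tj]; apply/nbP; exists j => //.
    rewrite /updf; case: eqP => // ji; by rewrite -ji jJ in iJ.
  exists (J `\ i); first by rewrite !inE eqxx.
  rewrite (cardfsD1 i J) iJ add1n ltnS in JA.
  apply: leq_trans JA; apply: fsubset_leq_card.
  apply/fsubsetP => t; rewrite in_fsetU => /orP[/nbP[j]|tz].
    rewrite !inE => /andP[ji jJ] tj; apply/nbP; exists j => //.
    by rewrite /updf (negbTE ji).
  by apply/nbP; exists i; rewrite // /updf eqxx.
apply: contrapT => /not_orP[/bad[J1 iJ1 c1] /bad[J2 iJ2 c2]].
have iJ12 : i \notin J1 `|` J2 by rewrite in_fsetU negb_or iJ1.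
have h1 := hA (i |` (J1 `|` J2)).
have h2 := hA (J1 `&` J2).
rewrite cardfsU1 iJ12 /= in h1.
have s1 : #|` \bigcup_(j <- i |` (J1 `|` J2)) A j| <=
    #|` ((\bigcup_(j <- J1) A j) `|` (A i `\ x)) `|`
         ((\bigcup_(j <- J2) A j) `|` (A i `\ y))|.
  apply/fsubset_leq_card/fsubsetP => t /nbP[j].
  rewrite !inE => /orP[/eqP ->|/orP[jJ|jJ]] tj.
  - rewrite tj !andbT; case: (eqVneq t x) => [->|]; last by rewrite orbT.
    by rewrite xy !orbT.
  - by apply/orP; left; apply/orP; left; apply/nbP; exists j.
  - by apply/orP; right; apply/orP; left; apply/nbP; exists j.
have s2 : #|` \bigcup_(j <- J1 `&` J2) A j| <=
    #|` ((\bigcup_(j <- J1) A j) `|` (A i `\ x)) `&`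
         ((\bigcup_(j <- J2) A j) `|` (A i `\ y))|.
  apply/fsubset_leq_card/fsubsetP => t /nbP[j].
  rewrite in_fsetI => /andP[j1 j2] tj; rewrite !inE; apply/andP; split.
  - by apply/orP; left; apply/nbP; exists j.
  - by apply/orP; left; apply/nbP; exists j.
(* As [x != y], the two deletions together restore [A i]. So the union and the intersection of the
   two enlarged neighbourhoods have sizes at least [1 + |J1 U J2|] and [|J1 n J2|], one too many in
   total. *)
have := cardfsUI ((\bigcup_(j <- J1) A j) `|` (A i `\ x))
                 ((\bigcup_(j <- J2) A j) `|` (A i `\ y)).
have := cardfsUI J1 J2.
lia.
Qed.

(** Induction on the size of [A i]: of two distinct elements one can always be deleted, and Hall's
    condition for [i] alone keeps the set nonempty. *)
Lemma hall_condition_singleton A i : hall_condition A ->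
  exists2 t, t \in A i & hall_condition (updf A i [fset t]).
Proof.
move: {2}#|` A i| (leqnn #|` A i|) => n.
elim: n A => [|n IH] A le_n hA.
  have := hA [fset i]; rewrite big_seq_fset1 cardfs1; lia.
have : 0 < #|` A i| by have := hA [fset i]; rewrite big_seq_fset1 cardfs1.
rewrite cardfs_gt0 => /fset0Pn[x xA].
case: (pselect (exists2 y, y \in A i & x != y)) => [[y yA xy]|nex]; last first.
  exists x => //; suff -> : updf A i [fset x] = A by [].
  apply: funext => j; rewrite /updf; case: eqP => // ->.
  apply/fsetP => t; rewrite inE; apply/eqP/idP => [->//|tA].
  by apply: contrapT => tx; apply: nex; exists t => //; apply/eqP => /esym.
have shrink z : z \in A i -> hall_condition (updf A i (A i `\ z)) ->
    exists2 t, t \in A i & hall_condition (updf A i [fset t]).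
  move=> zA hz.
  have [|t] := IH _ _ hz.
    by rewrite /updf eqxx; move: le_n; rewrite (cardfsD1 z) zA.
  rewrite {1}/updf eqxx => /fsetD1P[_ tA] ht; exists t => //.
  congr hall_condition: ht; apply: funext => j.
  by rewrite /updf; case: eqP.
by have [/shrink|/shrink] := hall_condition_delete hA xA yA xy; apply.
Qed.

(* The sets [A i] are shrunk to singletons one at a time, in the order of [c]. *)
Lemma hall_marriage A (c : I -> nat) : injective c -> hall_condition A ->
  exists2 f : I -> T, injective f & forall i, f i \in A i.
Proof.
move=> c_inj hA.
pose P := {B | hall_condition B}.
pose R n (B B' : P) := (forall i, sval B' i `<=` sval B i) /\
  forall i, c i = n -> exists t, sval B' i = [fset t].
have step n B : {B' | R n B B'}.
  apply: cid; case: B => B hB.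
  case: (pselect (exists i, c i = n)) => [[i ci]|nex]; last first.
    by exists (exist _ B hB); split=> // i ci; case: nex; exists i.
  have [t tB ht] := hall_condition_singleton i hB.
  exists (exist _ _ ht); split=> j /=.
    by rewrite /updf; case: eqP => [->|//]; rewrite fsub1set.
  by rewrite -ci => /c_inj ->; exists t; rewrite /updf eqxx.
pose fix B n : P := if n is m.+1 then sval (step m (B m)) else exist _ A hA.
have BS n : R n (B n) (B n.+1) := svalP (step n (B n)).
have Bmono m n : m <= n -> forall i, sval (B n) i `<=` sval (B m) i.
  elim: n => [|n IH]; first by rewrite leqn0 => /eqP ->.
  rewrite leq_eqVlt => /orP[/eqP -> //|/IH h] i.
  exact: fsubset_trans ((BS n).1 i) (h i).
(* Stage [n] treats the index of code [n], so the partner of [i] is read off one stage later, at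
   [(c i).+1]. *)
have /choice[f fP] i : exists t, sval (B (c i).+1) i = [fset t].
  exact: (BS _).2.
exists f => [i j fij|i]; last first.
  by apply: (fsubsetP (Bmono 0 (c i).+1 isT i)); rewrite fP inE.
apply: contrapT => /eqP ij.
(* If [f i = f j], then at a stage past both codes the sets of [i] and [j] lie in the same
   singleton, against Hall's condition for the pair. *)
pose N := maxn (c i).+1 (c j).+1.
have := svalP (B N) [fset i; j].
rewrite cardfs2 ij /= leqNgt => /negP; apply; rewrite ltnS.
rewrite -(cardfs1 (f i)); apply/fsubset_leq_card/fsubsetP => t /nbP[k].
rewrite in_fset2 => /orP[/eqP ->|/eqP ->] tk.
  by have := fsubsetP (Bmono (c i).+1 N (leq_maxl _ _) i) _ tk; rewrite fP.
by rewrite fij; have := fsubsetP (Bmono (c j).+1 N (leq_maxr _ _) j) _ tk;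
  rewrite fP.
Qed.

End hall.

(** * Folner sets from invariant means *)

Lemma cardfsM (K L : choiceType) (A : {fset K}) (B : {fset L}) :
  #|` A `*` B|%fset = (#|` A| * #|` B|)%N.
Proof.
rewrite -(size_allpairs pair); apply/perm_size/uniq_perm.
- exact: fset_uniq.
- by apply: allpairs_uniq; [exact: fset_uniq|exact: fset_uniq|case=> ? ? [] *].
move=> [a b]; rewrite in_fsetM /=.
by apply/andP/allpairsP => [[aA bB]|[[a' b'] [aA bB [-> ->]]]] //; exists (a, b).
Qed.

Section folner.
Context {G : groupType}.
Implicit Types (K F : {fset G}).

Definition mulfs K F : {fset G} := [fset (k * g)%g | k in K, g in F]%fset.

Lemma mulfsP K F x :
  reflect (exists2 k, k \in K & exists2 g, g \in F & x = (k * g)%g)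
          (x \in mulfs K F).
Proof.
apply: (iffP idP) => [/imfset2P[k kK [g gF ->]]|[k kK [g gF ->]]].
  by exists k => //; exists g.
by apply/imfset2P; exists k => //; exists g.
Qed.

Lemma mulfsA K1 K2 F : mulfs K1 (mulfs K2 F) = mulfs (mulfs K1 K2) F.
Proof.
apply/fsetP => x; apply/mulfsP/mulfsP.
  move=> [a aK [_ /mulfsP[b bK [g gF ->]] ->]].
  exists (a * b)%g; [by apply/mulfsP; exists a => //; exists b|].
  by exists g; rewrite // mulgA.
move=> [_ /mulfsP[a aK [b bK ->]] [g gF ->]].
exists a => //; exists (b * g)%g; last by rewrite mulgA.
by apply/mulfsP; exists b => //; exists g.
Qed.

Lemma mul1fs F : mulfs [fset 1%g]%fset F = F.
Proof.
apply/fsetP => x; apply/mulfsP/idP => [[_ /fset1P -> [g gF ->]]|xF].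
  by rewrite mul1g.
by exists 1%g; [rewrite inE|exists x; rewrite ?mul1g].
Qed.

Definition finitely_additive (R : realType) (m : set G -> R) :=
  forall A B, A `&` B = set0 -> m (A `|` B) = m A + m B.

Section finitely_additive.
Context {R : realType} (m : set G -> R)
        (m_ge0 : forall A, 0 <= m A) (mD : finitely_additive m).

Lemma finitely_additive0 : m set0 = 0.
Proof. by have := mD (setI0 set0); rewrite setU0; lra. Qed.

Lemma finitely_additive_bigsetU (I : choiceType) (s : seq I) (A : I -> set G) :
  uniq s -> (forall i j g, A i g -> A j g -> i = j) ->
  m (\big[setU/set0]_(i <- s) A i) = \sum_(i <- s) m (A i).
Proof.
move=> + disj; elim: s => [|i s IH] /=; first by rewrite !big_nil finitely_additive0.
move=> /andP[iNs us]; rewrite !big_cons mD ?IH//.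
apply/seteqP; split=> // g [Ag].
rewrite -bigcup_seq => -[j /= js Aj].
by rewrite (disj _ _ _ Ag Aj) js in iNs.
Qed.

Lemma finitely_additive_le (A B : set G) : A `<=` B -> m A <= m B.
Proof.
move=> AB; rewrite -(setDUK AB) mD ?lerDl//.
by apply/seteqP; split=> // g [Ag [_ /(_ Ag)]].
Qed.

End finitely_additive.

(* If [#|K F| >= 2 #|F|] for all [F], then Hall's theorem yields two injections
   with disjoint ranges moving points only by [K], i.e. a paradoxical
   decomposition of [G]. *)
Lemma amenable_not_doubling (R : realType) (c : G -> nat) K :
  injective c -> amenable R G ->
  exists F, (#|` mulfs K F| < 2 * #|` F|)%N.
Proof.
move=> c_inj [m [m_ge0 m1 mD mJ]]; apply: contrapT => /forallNP doubling.
have {}doubling F : (2 * #|` F| <= #|` mulfs K F|)%N.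
  by rewrite leqNgt; apply/negP.
(* Each [g] enters twice, and both copies look for a partner in [K g]. *)
pose A (i : G * bool) := mulfs K [fset i.1]%fset.
have hA : hall_condition A.
  move=> J; pose F := [fset i.1 | i in J]%fset.
  apply: (@leq_trans (2 * #|` F|)).
    have -> : (2 * #|` F|)%N = #|` F `*` [fset true; false]|%fset.
      by rewrite cardfsM cardfs2 mulnC.
    apply/fsubset_leq_card/fsubsetP => -[g b] gbJ; rewrite in_fsetM.
    have -> : g \in F by apply/imfsetP; exists (g, b).
    by rewrite !inE; case: b {gbJ}.
  apply: leq_trans (doubling F) _; apply/fsubset_leq_card/fsubsetP => x.
  move=> /mulfsP[k kK [_ /imfsetP[i iJ ->] ->]].
  apply/bigfcupP; exists i; first by rewrite iJ.
  by apply/mulfsP; exists k => //; exists i.1; rewrite ?inE.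
pose code (i : G * bool) := choice.pickle (c i.1, i.2).
have [|f f_inj fA] := @hall_marriage _ _ A code _ hA.
  by move=> [g b] [g' b'] /(pcan_inj choice.pickleK)[/c_inj -> ->].
have /choice[k kP] i : exists k, k \in K /\ f i = (k * i.1)%g.
  by have /mulfsP[k kK [_ /fset1P -> ->]] := fA i; exists k.
(* For fixed [b] the pieces [P b s] partition [G]; translating each by its own [s] yields the range
   [Q b] of one injection. So both ranges have mean 1, although they are disjoint. *)
pose P b s := [set g | k (g, b) = s].
pose Q b := \big[setU/set0]_(s <- K) [set (s * g)%g | g in P b s].
have QE b x : Q b x -> exists g, x = f (g, b).
  rewrite /Q -bigcup_seq => -[s _ [g /= kg <-]]; exists g.
  by rewrite (kP (g, b)).2 kg.
have mQ b : m (Q b) = 1.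
  rewrite finitely_additive_bigsetU //; last first.
    move=> s s' x [g /= kg gx] [g' /= kg' gx'].
    have : f (g, b) = f (g', b).
      by rewrite (kP (g, b)).2 (kP (g', b)).2 kg kg' gx.
    by move=> /f_inj[gg']; rewrite -kg -kg' gg'.
  under eq_bigr do rewrite mJ.
  rewrite -finitely_additive_bigsetU //; last by move=> s s' g <- <-.
  rewrite -m1; congr m; apply/seteqP; split=> // g _.
  by rewrite -bigcup_seq; exists (k (g, b)) => //=; exact: (kP _).1.
have : m (Q true `|` Q false) <= m setT by exact: finitely_additive_le.
rewrite m1 mD ?mQ; first by lra.
by apply/seteqP; split=> // x [/QE[g ->] /QE[g' /f_inj]].
Qed.

(** Outgoing edges of the Cayley graph, recorded by label and source. Edges are counted rather than
    points because both ends of an edge will be charged to the boundary of a tile. *)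
Definition leaving (S F : {fset G}) : {fset G * G} :=
  [fset p in S `*` F | (p.1 * p.2)%g \notin F]%fset.

Lemma leavingP (S F : {fset G}) s g : reflect
  [/\ s \in S, g \in F & (s * g)%g \notin F] ((s, g) \in leaving S F).
Proof.
rewrite /leaving !inE /=; apply: (iffP andP) => [[/andP[]]|[]] //.
by move=> -> -> ->.
Qed.

(** If no [F] works, [S1] enlarges every finite set by the factor [1 + d]; iterating this doubles
    every finite set, which [amenable_not_doubling] forbids. *)
Lemma amenable_folner (R : realType) (c : G -> nat) (S : {fset G}) (e : R) :
  injective c -> amenable R G -> 0 < e ->
  exists2 F : {fset G}, F != fset0 &
    (#|` leaving S F|)%:R <= e * (#|` F|)%:R.
Proof.
move=> c_inj amG e0; apply: contrapT => /forall2NP nF.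
pose S1 := (1%g |` S)%fset.
(* A point outside [F] is the end of at most [|S|] leaving edges; the extra 1 keeps the denominator
   positive. *)
pose d := e / (#|` S|.+1)%:R.
have d0 : 0 < d by rewrite divr_gt0.
have expand F : (1 + d) * (#|` F|)%:R <= (#|` mulfs S1 F|)%:R.
  have [->|F0] := eqVneq F fset0; first by rewrite cardfs0 mulr0.
  have /= := nF F; rewrite F0 => -[//|/negP]; rewrite -ltNge => eF.
  have FS1 : (F `<=` mulfs S1 F)%fset.
    apply/fsubsetP => g gF; apply/mulfsP; exists 1%g; first by rewrite !inE eqxx.
    by exists g; rewrite ?mul1g.
  have le1 : (#|` leaving S F| <= #|` S|.+1 * #|` (mulfs S1 F `\` F)%fset|)%N.
    apply: (@leq_trans (#|` S| * #|` (mulfs S1 F `\` F)%fset|)); last first.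
      by rewrite leq_mul2r leqnSn orbT.
    have <- : #|` [fset (p.1, (p.1 * p.2)%g) | p in leaving S F]%fset| =
        #|` leaving S F|.
      by apply: card_in_imfset => -[s g] [s' g'] _ _ /= [<-] /mulgI ->.
    rewrite -cardfsM.
    apply/fsubset_leq_card/fsubsetP => _ /imfsetP[[s g] /leavingP[sS gF sgF] ->] /=.
    rewrite in_fsetM sS /= inE sgF; apply/mulfsP.
    by exists s; [rewrite !inE sS orbT|exists g].
  rewrite mulrDl mul1r -(cardfsID F (mulfs S1 F)) (fsetIidPr FS1) natrD lerD2l.
  rewrite /d mulrAC ler_pdivrMr// mulrC; apply: le_trans (ltW _) _.
    by rewrite mulrC; exact: eF.
  by rewrite mulrC -natrM ler_nat.
clearbody d.
(* Chosen with [k * d >= 1], so that [1 + k * d] reaches the factor 2. *)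
pose k := (Num.truncn d^-1).+1.
pose SK j := iter j (mulfs S1) [fset 1%g]%fset.
(* Bernoulli's inequality for the powers of [1 + d], proved along the iteration. *)
have grow j F : (1 + j%:R * d) * (#|` F|)%:R <= (#|` mulfs (SK j) F|)%:R.
  elim: j => [|j IH]; first by rewrite mul0r addr0 mul1r mul1fs.
  rewrite /SK iterS -/(SK j) -mulfsA; apply: le_trans (expand _).
  have d1 : 0 <= 1 + d by rewrite addr_ge0// ltW.
  apply: le_trans (ler_wpM2l d1 IH).
  rewrite mulrA; apply: ler_wpM2r => //; rewrite -(natr1 j) mulrDl.
  have : 0 <= j%:R * d * d by rewrite !mulr_ge0// ltW.
  by lra.
have [F] := amenable_not_doubling (SK k) c_inj amG.
apply/negP; rewrite -leqNgt -(ler_nat R) natrM.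
apply: le_trans (grow k F); rewrite ler_wpM2r//.
suff : 1 <= k%:R * d by lra.
rewrite -ler_pdivrMr// mul1r ltW//.
by have /truncn_itv/andP[_] : 0 <= d^-1 by rewrite invr_ge0 ltW.
Qed.

End folner.

(** * Countability of finitely generated groups *)

Section finitely_generated.
Context {G : groupType} (S : set G).

Lemma generates_subgroup (H : set G) :
  generates S -> is_subgroup H -> S `<=` H -> forall g, H g.
Proof.
move=> gS sH SH g; have : [set: G] g by [].
by rewrite -gS; apply; split.
Qed.

(** Words over an enumeration of [S], written as lists of indices, are countable in number. Their
    values form a subgroup, by symmetry of [S], so every element is the value of some word. *)
Lemma finitely_generated_countable :
  finite_set S -> symmetric_set S -> generates S ->
  exists c : G -> nat, injective c.
Proof.
move=> /finite_seqP[s sS] symS gS.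
pose eval (w : seq nat) := foldr (fun i h => (nth 1%g s i * h)%g) 1%g w.
have evalD v w : eval (v ++ w) = (eval v * eval w)%g.
  by elim: v => [|i v IH] /=; rewrite ?mul1g// IH mulgA.
have evalV w : exists v, eval v = (eval w)^-1%g.
  elim: w => [|i w [v vE]]; first by exists [::]; rewrite /= invg1.
  exists (v ++ [:: index (nth 1 s i)^-1 s])%g.
  rewrite evalD vE /= invgM mulg1; congr (_ * _)%g.
  (* An index past the end of [s] names the identity, and so does [index 1 s], whether or not the
     identity occurs in [s]. *)
  have [iS|Si] := ltnP i (size s); last first.
    rewrite (nth_default _ Si) invg1.
    case: (boolP (1%g \in s)) => [?|s1]; first by rewrite nth_index.
    by rewrite nth_default// memNindex.
  rewrite nth_index//.
  have : S (nth 1%g s i) by rewrite sS /= mem_nth.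
  by move=> /symS; rewrite sS.
have /choice[w wE] : forall g, exists w, eval w = g.
  apply: (@generates_subgroup [set g | exists w, eval w = g]) => //.
    split=> [|g h [v <-] [w <-]|g [w <-]]; first by exists [::].
    - by exists (v ++ w).
    - exact: evalV.
  move=> g; rewrite sS => /= gs; exists [:: index g s].
  by rewrite /= mulg1 nth_index.
exists (choice.pickle \o w); apply: inj_comp; first exact: pcan_inj choice.pickleK.
exact: can_inj wE.
Qed.

End finitely_generated.

(** * Separating sequences and a Borel linear order *)

Section countably_separated.

Definition separating (X : Type) (A : nat -> set X) :=
  forall x y, x <> y -> exists n, A n x /\ ~ A n y.

Lemma standard_borel_separating (R : realType) d (X : measurableType d) :
  standard_borel R X ->
  exists2 A : nat -> set X, (forall n, measurable (A n)) & separating A.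
Proof.
move=> [T [f [hT [D cD dD] bij_f mE]]].
have /countable_injP[c c_inj] := cD.
pose r k : R := k.+1%:R^-1.
have r0 k : 0 < r k by rewrite invr_gt0.
(* At most one point of [D] has code [i], so [O i k] is the interior of a ball about that point, or
   empty. *)
pose O i k := \bigcup_(t in [set t | D t /\ c t = i]) interior (ball t (r k)).
pose A n := if choice.unpickle n is Some (i, k) then f @^-1` O i k else set0.
exists A => [n|x y xy].
  rewrite /A; case: choice.unpickle => // -[i k]; rewrite mE.
  exists (O i k) => //; apply: sub_gen_smallest.
  by apply: bigcup_open => t _; exact: open_interior.
have fxy : f x != f y by apply/eqP => /(bij_inj bij_f).
move: hT; rewrite open_hausdorff => /(_ _ _ fxy)[[U V] /= [xU yV] [oU oV /eqP UV]].
rewrite inE in xU; rewrite inE in yV.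
have /nbhs_ballP[e /= e0 eU] : nbhs (f x) U by exact: open_nbhs_nbhs.
(* With radius below [e / 2] and a centre within half that radius of [f x], the ball contains [f x]
   and stays inside the [e]-ball about [f x], which misses [f y]. *)
pose k := Num.truncn (e / 2)^-1.
have rk : r k < e / 2.
  rewrite /r -ltf_pV2 ?posrE ?divr_gt0// invrK.
  by have /truncn_itv/andP[_] : 0 <= (e / 2)^-1 by rewrite invr_ge0 divr_ge0// ltW.
have [t [xt Dt]] : (interior (ball (f x) (r k / 2)) `&` D) !=set0.
  apply: dD; last exact: open_interior.
  by exists (f x); apply: nbhsx_ballx; rewrite divr_gt0.
have {}xt := interior_subset xt.
exists (choice.pickle (c t, k)); rewrite /A choice.pickleK; split.
  exists t => //=; apply/nbhs_ballP; exists (r k / 2) => /=; first by rewrite divr_gt0.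
  move=> z xz; rewrite (splitr (r k)); exact: ball_triangle (ball_sym xt) xz.
move=> [t' [Dt' /c_inj ctt]] /interior_subset yt; move: yt.
rewrite ctt ?inE// => yt.
have : (U `&` V) (f y).
  split=> //; apply: eU; rewrite (splitr e).
  apply: ball_triangle (le_ball (ltW rk) yt).
  apply: le_ball xt; rewrite (le_trans _ (ltW rk))// ler_pdivrMr// ler_pMr//.
  by rewrite ler1n.
by rewrite UV.
Qed.

(** Two values differ exactly when some [A n] contains the first but not the second, a countable
    condition. Applied to the two projections, this makes the diagonal of [X * X] measurable. *)
Lemma measurable_eq d (X : measurableType d) (A : nat -> set X) :
  (forall n, measurable (A n)) -> separating A ->
  forall d' (Z : measurableType d') (f g : Z -> X),
  measurable_fun setT f -> measurable_fun setT g ->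
  measurable [set z | f z = g z].
Proof.
move=> mA sepA d' Z f g mf mg.
have mpre (h : Z -> X) n : measurable_fun setT h -> measurable (h @^-1` A n).
  by move=> mh; rewrite -[X in measurable X]setTI; apply: mh.
rewrite (_ : [set _ | _] = ~` \bigcup_n ((f @^-1` A n) `&` ~` (g @^-1` A n))).
  apply/measurableC/bigcup_measurable => n _.
  by apply: measurableI; [exact: mpre|apply/measurableC/mpre].
apply/seteqP; split=> z /=.
  by move=> fg [n _ [fA gA]]; apply: gA; rewrite /= -fg.
move=> h; apply: contrapT => /sepA[n [fA gA]].
by apply: h; exists n.
Qed.

(** The lexicographic order on 0-1 sequences, pulled back along the map sending a point to its
    memberships in the sets [A n]; [n] is the first coordinate that differs. *)
Definition lexi_lt (X : Type) (A : nat -> set X) (x y : X) :=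
  exists n, [/\ A n y, ~ A n x & forall k, (k < n)%N -> A k x <-> A k y].

Context {X : choiceType} (A : nat -> set X) (sepA : separating A).

Lemma lexi_lt_trans x y z : lexi_lt A x y -> lexi_lt A y z -> lexi_lt A x z.
Proof.
move=> [n [yn xn xyn]] [m [zm ym yzm]].
have [nm|mn|nm] := ltngtP n m.
- exists n; split=> // [|k kn]; first exact/yzm.
  by rewrite xyn// yzm// (ltn_trans kn).
- exists m; split=> // [|k km]; first by rewrite xyn.
  by rewrite xyn ?yzm// (ltn_trans km).
- by rewrite nm in yn.
Qed.

Lemma lexi_lt_irr x : ~ lexi_lt A x x.
Proof. by move=> [n []]. Qed.

Lemma lexi_lt_total x y : x <> y -> lexi_lt A x y \/ lexi_lt A y x.
Proof.
move=> /sepA[n [xn yn]].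
have ex : exists n, `[< A n x <> A n y >].
  by exists n; apply/asboolP => xy; apply: yn; rewrite -xy.
case: (ex_minnP ex) => m /asboolP xym min_m.
have low k : (k < m)%N -> A k x = A k y.
  move=> km; apply: contrapT => xyk; have := min_m k.
  by rewrite leqNgt km => /(_ (asboolT xyk)).
case: (pselect (A m x)) => Ax; case: (pselect (A m y)) => Ay.
- by case: xym; rewrite propeqE.
- by right; exists m; split=> // k /low ->.
- by left; exists m; split=> // k /low ->.
- by case: xym; rewrite propeqE.
Qed.

Lemma lexi_min (B : set X) : finite_set B -> B !=set0 ->
  exists2 x, B x & forall y, B y -> ~ lexi_lt A y x.
Proof.
move=> /finite_seqP[[|x0 s] ->]; first by move=> [].
move=> _; elim: s => [|y s [x xs xmin]].
  exists x0; rewrite /= ?inE// => _ /[!inE]/eqP ->; exact: lexi_lt_irr.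
case: (pselect (lexi_lt A y x)) => yx.
  exists y => [|z]; first by rewrite /= !inE eqxx orbT.
  rewrite /= !inE orbCA => /predU1P[->|zs]; first exact: lexi_lt_irr.
  by move=> zy; apply: (xmin z); [rewrite /= inE|exact: lexi_lt_trans zy yx].
exists x => [|z]; first by move: xs; rewrite /= !inE => /orP[]->; rewrite ?orbT.
by rewrite /= !inE orbCA => /predU1P[->//|zs]; apply: xmin; rewrite /= inE.
Qed.

End countably_separated.

(** * Countable set operations and real-valued probabilities *)

Lemma measurable_preimage d d' (Z : measurableType d) (X : measurableType d')
    (f : Z -> X) (A : set X) :
  measurable_fun setT f -> measurable A -> measurable (f @^-1` A).
Proof. by move=> mf mA; rewrite -[X in measurable X]setTI; exact: mf. Qed.

Lemma countable_bigcup_measurable d (X : measurableType d) (I : Type)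
    (B : set I) (F : I -> set X) :
  countable [set: I] -> (forall i, B i -> measurable (F i)) ->
  measurable (\bigcup_(i in B) F i).
Proof.
move=> cI mF; rewrite bigcup_mkcond; apply: countable_bigcupT_measurable => // i.
by case: ifP => // /set_mem; exact: mF.
Qed.

Lemma countable_bigcap_measurable d (X : measurableType d) (I : Type)
    (B : set I) (F : I -> set X) :
  countable [set: I] -> (forall i, B i -> measurable (F i)) ->
  measurable (\bigcap_(i in B) F i).
Proof.
move=> cI mF; rewrite -(setCK (bigcap _ _)) setC_bigcap.
by apply/measurableC/countable_bigcup_measurable => // i /mF/measurableC.
Qed.

Section real_probability.
Context {R : realType} {d} {X : measurableType d} (mu : probability X R).

Definition prob (A : set X) : R := fine (mu A).

Lemma probE A : measurable A -> mu A = (prob A)%:E.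
Proof. by move=> mA; rewrite fineK// fin_num_measure. Qed.

Lemma prob_ge0 A : 0 <= prob A.
Proof. by rewrite fine_ge0. Qed.

Lemma probT : prob setT = 1.
Proof. by rewrite /prob probability_setT. Qed.

Lemma prob0 : prob set0 = 0.
Proof. by rewrite /prob measure0. Qed.

Lemma probU A B : measurable A -> measurable B -> A `&` B = set0 ->
  prob (A `|` B) = prob A + prob B.
Proof.
move=> mA mB AB; apply: EFin_inj.
by rewrite EFinD -!probE ?measureU//; exact: measurableU.
Qed.

Lemma le_prob A B : measurable A -> measurable B -> A `<=` B ->
  prob A <= prob B.
Proof.
by move=> mA mB AB; rewrite -lee_fin -!probE// le_measure// inE.
Qed.

Lemma prob_le1 A : measurable A -> prob A <= 1.
Proof. by move=> mA; rewrite -probT; exact: le_prob. Qed.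

Lemma probU_le A B : measurable A -> measurable B ->
  prob (A `|` B) <= prob A + prob B.
Proof.
move=> mA mB; rewrite -lee_fin EFinD -!probE//; last exact: measurableU.
exact: measureU2.
Qed.

Lemma probC A : measurable A -> prob (~` A) = 1 - prob A.
Proof.
move=> mA; rewrite -probT -(setUv A) probU//; first by rewrite addrAC subrr add0r.
- exact: measurableC.
- exact: setICr.
Qed.

End real_probability.

(** * Ultralimits of bounded sequences *)

Section ultralimit.

Lemma ultrafilter_nat : exists U : set_system nat,
  UltraFilter U /\ (forall A, \oo A -> U A).
Proof. by have [U [UU h]] := ultraFilterLemma (eventually_filter); exists U. Qed.

Lemma fmap_ultra (T V : Type) (f : T -> V) (U : set_system T) :
  UltraFilter U -> UltraFilter (f @ U).
Proof.
move=> UU; split=> [|F PF fUF]; first exact: fmap_proper_filter.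
apply/seteqP; split=> // A FA.
have [//|nA] := in_ultra_setVsetC (f @^-1` A) UU.
have : F (A `&` ~` A) by apply: filterI => //; exact: fUF.
by rewrite setICr => /filter_not_empty.
Qed.

Lemma ultralimit_exists (R : realType) (U : set_system nat) (u : nat -> R) :
  UltraFilter U -> (forall n, 0 <= u n <= 1) ->
  exists l : R, u n @[n --> U] --> l.
Proof.
move=> UU u01; have := @segment_compact R 0 1; rewrite compact_ultra.
move=> /(_ (u @ U) (fmap_ultra _ UU)) [].
  by apply: (@filterE _ U _ (u @^-1` `[0, 1])) => n; rewrite /= in_itv /=.
by move=> l [_ ul]; exists l.
Qed.

End ultralimit.

(** * Unions, monotone limits and averaging *)

Section probability_lemmas.
Context {R : realType} {d} {X : measurableType d} (mu : probability X R).
Local Notation P := (prob mu).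

Lemma prob_bigsetU (I : choiceType) (s : seq I) (U : I -> set X) :
  uniq s -> (forall i, measurable (U i)) ->
  (forall i j x, i \in s -> j \in s -> U i x -> U j x -> i = j) ->
  P (\big[setU/set0]_(i <- s) U i) = \sum_(i <- s) P (U i).
Proof.
move=> + mU; elim: s => [|i s IH] /=; first by rewrite !big_nil prob0.
move=> /andP[iNs us] disj; rewrite !big_cons probU ?IH//.
- by move=> j k x js ks; apply: disj; rewrite inE ?js ?ks orbT.
- exact: bigsetU_measurable.
apply/seteqP; split=> // x [Ux]; rewrite -bigcup_seq => -[j /= js Uj].
have ij : i = j by apply: disj Ux Uj; rewrite inE ?eqxx// js orbT.
by rewrite ij js in iNs.
Qed.

Lemma prob_bigsetU_le (I : choiceType) (s : seq I) (U : I -> set X) :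
  (forall i, measurable (U i)) ->
  P (\big[setU/set0]_(i <- s) U i) <= \sum_(i <- s) P (U i).
Proof.
move=> mU; elim: s => [|i s IH] /=; first by rewrite !big_nil prob0.
rewrite !big_cons; apply: le_trans (probU_le _ _ _) _ => //.
  exact: bigsetU_measurable.
by rewrite lerD2l.
Qed.

Lemma prob_bigcup_gt0 (U : nat -> set X) : (forall n, measurable (U n)) ->
  0 < P (\bigcup_n U n) -> exists n, 0 < P (U n).
Proof.
move=> mU; apply: contraPP => /forallNP U0; apply/negP; rewrite -leNgt.
suff : mu.-negligible (\bigcup_n U n).
  by move=> /negligibleP; rewrite /prob => ->//; exact: bigcup_measurable.
apply: negligible_bigcup => n; apply/(negligibleP mu (mU n)).
have Un0 : P (U n) = 0.
  by apply/eqP; rewrite eq_le prob_ge0 andbT leNgt; exact/negP.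
by have := probE mu (mU n); rewrite Un0.
Qed.

Lemma prob_bigcup_cvg (U : nat -> set X) : (forall n, measurable (U n)) ->
  (forall n, U n `<=` U n.+1) ->
  P (U n) @[n --> \oo] --> P (\bigcup_n U n).
Proof.
move=> mU incU; apply: fine_cvg; rewrite fineK ?fin_num_measure//; last first.
  exact: bigcup_measurable.
apply: nondecreasing_cvg_mu => //; first exact: bigcup_measurable.
by apply/nondecreasing_seqP => n; apply/subsetPset.
Qed.

Lemma prob_bigcup_le (U : nat -> set X) a : (forall n, measurable (U n)) ->
  (forall n, U n `<=` U n.+1) -> (forall n, P (U n) <= a) ->
  P (\bigcup_n U n) <= a.
Proof.
move=> mU incU Ua; rewrite -(cvg_lim (@Rhausdorff R) (prob_bigcup_cvg mU incU)).
apply: limr_le; last by apply: nearW.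
by apply/cvg_ex; eexists; exact: prob_bigcup_cvg.
Qed.

(** When [U f] is the preimage of a set [Y] under [f], this counts the [f] in [s] that send [x] into
    [Y]. *)
Definition hits (I : Type) (s : seq I) (U : I -> set X) (x : X) : R :=
  \sum_(i <- s) \1_(U i) x.

Lemma hits_ge0 (I : Type) (s : seq I) (U : I -> set X) x : 0 <= hits s U x.
Proof. by apply: sumr_ge0 => i _; rewrite indicE. Qed.

Lemma measurable_hits (I : Type) (s : seq I) (U : I -> set X) (C : set X) :
  (forall i, measurable (U i)) -> measurable_fun C (hits s U).
Proof.
move=> mU; apply: measurable_sum => i.
exact: measurable_indic.
Qed.

Lemma integral_hits (I : Type) (s : seq I) (U : I -> set X) (C : set X) (a : R) :
  0 <= a -> measurable C -> (forall i, measurable (U i)) ->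
  (\int[mu]_(x in C) (a * hits s U x)%:E =
    (a * \sum_(i <- s) P (C `&` U i))%:E)%E.
Proof.
move=> a0 mC mU; under eq_integral do rewrite EFinM.
rewrite ge0_integralZl_EFin//=; last first.
- by apply/measurable_EFinP; exact: measurable_hits.
- by move=> x _; rewrite lee_fin hits_ge0.
rewrite EFinM; congr (_ * _)%E; rewrite /hits.
under eq_integral do rewrite -sumEFin.
rewrite ge0_integral_sum//; last first.
  by move=> i; apply/measurable_EFinP; exact: measurable_indic.
rewrite -sumEFin; apply: eq_bigr => i _.
by rewrite integral_indic// setIC; apply: probE; exact: measurableI.
Qed.

(** Integrating the pointwise inequality over [C] turns counts along an orbit into sums of
    measures. *)
Lemma le_sum_prob (I J : Type) (s : seq I) (t : seq J) (U : I -> set X)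
    (V : J -> set X) (C : set X) (a b : R) :
  0 <= a -> 0 <= b -> measurable C ->
  (forall i, measurable (U i)) -> (forall j, measurable (V j)) ->
  (forall x, C x -> a * hits s U x <= b * hits t V x) ->
  a * \sum_(i <- s) P (C `&` U i) <= b * \sum_(j <- t) P (C `&` V j).
Proof.
move=> a0 b0 mC mU mV le; rewrite -lee_fin -!integral_hits//.
apply: ge0_le_integral => //.
- by move=> x _; rewrite lee_fin mulr_ge0// hits_ge0.
- apply/measurable_EFinP; apply: measurable_funM => //; exact: measurable_hits.
- apply/measurable_EFinP; apply: measurable_funM => //; exact: measurable_hits.
Qed.

Lemma measurable_lt_hits (I J : Type) (s : seq I) (t : seq J) (U : I -> set X)
    (V : J -> set X) (a b : R) :
  (forall i, measurable (U i)) -> (forall j, measurable (V j)) ->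
  measurable [set x | a * hits s U x < b * hits t V x].
Proof.
move=> mU mV.
have : measurable_fun setT (fun x => a * hits s U x < b * hits t V x).
  apply: measurable_fun_ltr; apply: measurable_funM => //; exact: measurable_hits.
move=> /(_ measurableT [set true] Logic.I); congr measurable.
by apply/seteqP; split=> x; [move=> [_]|].
Qed.

End probability_lemmas.

(** A form of Zorn's lemma in which only sequences need upper bounds: climb so that after step [n]
    the value [v] can grow by at most [1/(n+1)]; a bound of the climb is then maximal for [v]. *)
Lemma exists_maximal (R : realType) (T : Type) (le : T -> T -> Prop)
    (v : T -> R) (a : R) :
  (forall x, le x x) -> (forall x y z, le x y -> le y z -> le x z) ->
  (forall x y, le x y -> v x <= v y) -> (forall x, v x <= a) ->
  (forall u : nat -> T, (forall n, le (u n) (u n.+1)) ->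
    exists x, forall n, le (u n) x) ->
  forall x0, exists2 x, le x0 x & forall y, le x y -> v y <= v x.
Proof.
move=> le_refl le_trans_ v_mono v_le chain x0.
have /choice[f fP] (xn : T * nat) : exists y, le xn.1 y /\
    forall z, le y z -> v z <= v y + xn.2.+1%:R^-1.
  case: xn => x n /=; pose E := [set v y | y in le x].
  have supE : has_sup E.
    by split; [exists (v x), x|exists a => _ [y _ <-]].
  have n0 : (0 : R) < n.+1%:R^-1 by rewrite invr_gt0.
  have [_ [y xy <-] lt_y] := sup_adherent n0 supE.
  exists y; split=> // z yz.
  rewrite -lerBlDr; apply: le_trans (ltW lt_y); rewrite lerD2r.
  by apply: ub_le_sup; [exact: supE.2|exists z => //; exact: le_trans_ yz].
pose fix u n := if n is m.+1 then f (u m, m) else x0.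
have [x ux] := chain u (fun n => (fP (u n, n)).1).
exists x => [|y xy]; first exact: (ux 0%N).
apply/ler_addgt0Pr => e e0.
pose n := Num.truncn e^-1.
have ne : n.+1%:R^-1 <= e.
  rewrite invf_ple ?posrE// ltW//.
  by have /truncn_itv/andP[_] : 0 <= e^-1 by rewrite invr_ge0 ltW.
apply: le_trans ((fP (u n, n)).2 y (le_trans_ _ _ _ (ux n.+1) xy)) _.
by apply: lerD => //; exact: v_mono (ux n.+1).
Qed.

(** * Isoperimetric profile of an action *)

Section action.
Context {R : realType} {d : measure_display} {X : measurableType d}
        {mu : probability X R} {G : groupType} {act : G -> X -> X}
        (S : set G) (A : nat -> set X).
Context (fin_S : finite_set S) (countable_G : countable [set: G])
        (mA : forall n, measurable (A n)) (sepA : separating A)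
        (act_action : is_group_action act) (act_mp : measure_preserving mu act).

Local Notation P := (prob mu).

Let code_exists : exists c : G -> nat, injective c.
Proof.
have /countable_injP[c c_inj] := countable_G.
by exists c => g h; apply: c_inj; rewrite inE.
Qed.

Lemma actK g : cancel (act g) (act g^-1%g).
Proof. by move=> x; rewrite -act_action.2 mulVg act_action.1. Qed.

Lemma actVK g : cancel (act g^-1%g) (act g).
Proof. by move=> x; rewrite -act_action.2 mulgV act_action.1. Qed.

Lemma measurable_act g : measurable_fun setT (act g).
Proof. exact: (act_mp g).1. Qed.

Lemma measurable_act_preimage g (B : set X) :
  measurable B -> measurable (act g @^-1` B).
Proof. exact/measurable_preimage/measurable_act. Qed.

Lemma prob_act g (B : set X) : measurable B -> P (act g @^-1` B) = P B.
Proof. by move=> mB; rewrite /prob (act_mp g).2. Qed.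

Lemma act_imageE g (B : set X) : act g @` B = act g^-1%g @^-1` B.
Proof.
apply/seteqP; split=> [_ [x Bx <-]|x /= Bx]; first by rewrite /= actK.
by exists (act g^-1%g x); rewrite ?actVK.
Qed.

Lemma measurable_act_eq g h : measurable [set x | act g x = act h x].
Proof. by apply: (measurable_eq mA sepA); exact: measurable_act. Qed.

Lemma measurable_rel_act (theta : set (X * X)) g h :
  measurable theta -> measurable [set x | theta (act g x, act h x)].
Proof.
move=> mt; apply: (measurable_preimage (f := fun x => (act g x, act h x))) => //.
by apply: measurable_fun_pair; exact: measurable_act.
Qed.

Lemma measurable_rel (theta : set (X * X)) g :
  measurable theta -> measurable [set x | theta (x, act g x)].
Proof.
move=> /(measurable_rel_act 1%g g); congr measurable.
by apply: funext => x; rewrite /= act_action.1.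
Qed.

Lemma measurable_lexi_lt g h :
  measurable [set x | lexi_lt A (act g x) (act h x)].
Proof.
pose B k : set X := (act g @^-1` A k `&` act h @^-1` A k) `|`
  (~` (act g @^-1` A k) `&` ~` (act h @^-1` A k)).
rewrite (_ : [set _ | _] = \bigcup_n (act h @^-1` A n `&`
    ~` (act g @^-1` A n) `&` \bigcap_(k in [set k | (k < n)%N]) B k)).
  have mg k g' : measurable (act g' @^-1` A k) by exact: measurable_act_preimage.
  apply: bigcup_measurable => n _; apply: measurableI.
    by apply: measurableI => //; exact: measurableC.
  apply: countable_bigcap_measurable => // k _.
  apply: measurableU; apply: measurableI => //; exact: measurableC.
apply/seteqP; split=> x /= [n].
  move=> [yn xn xy]; exists n => //; split=> // k /= kn.
  case: (pselect (A k (act g x))) => xk; first by left; split=> //; exact/xy.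
  by right; split=> //= /(xy k kn).
move=> _ [[yn xn] xy]; exists n; split=> // k /xy[[kx ky]|[kx ky]]; split=> //.
Qed.

Lemma measurable_boundary (theta : set (X * X)) :
  measurable theta -> measurable (boundary act S theta).
Proof.
move=> mt; rewrite (_ : boundary _ _ _ =
    \bigcup_(s in S) ~` [set x | theta (x, act s x)]).
  by apply: countable_bigcup_measurable => // s _; exact/measurableC/measurable_rel.
by apply/seteqP; split=> x [s ? ?]; exists s.
Qed.

(** * Points with trivial stabiliser *)

(** Essential freeness speaks of one [g] at a time. As [G] is countable it makes this single
    invariant set conull, and there a group element is determined by its effect on one point. *)
Definition free_part : set X :=
  [set x | forall g, g <> 1%g -> act g x <> x].

Lemma free_part_act g x : free_part x -> free_part (act g x).
Proof.
move=> fx h h1; rewrite -act_action.2 => /(congr1 (act g^-1%g)).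
rewrite actK -act_action.2; apply: fx => E; apply: h1.
have := congr1 (fun k => g * k * g^-1)%g E.
by rewrite /= !mulgA mulgV mul1g mulgK mulg1 mulgV.
Qed.

Lemma free_part_inj x g h : free_part x -> act g x = act h x -> g = h.
Proof.
move=> fx /(congr1 (act h^-1%g)); rewrite actK -act_action.2 => E.
apply: contrapT => gh; apply: (fx (h^-1 * g)%g) E.
by move=> /(congr1 (fun k => h * k)%g); rewrite mulgA mulgV mul1g mulg1.
Qed.

Lemma free_partE : ~` free_part =
  \bigcup_(g in [set g | g <> 1%g]) [set x | act g x = act 1%g x].
Proof.
apply/seteqP; split=> x /=.
  move=> /existsNP[g /not_implyP[g1 /contrapT gx]]; exists g => //=.
  by rewrite gx act_action.1.
by move=> [g g1 /= gx] /(_ g g1); rewrite gx act_action.1.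
Qed.

Lemma measurable_free_part : measurable free_part.
Proof.
rewrite -(setCK free_part) free_partE; apply: measurableC.
by apply: countable_bigcup_measurable => // g _; exact: measurable_act_eq.
Qed.

Lemma prob_free_part : essentially_free mu act -> P free_part = 1.
Proof.
move=> free; have [c c_inj] := code_exists.
have mf := measurable_free_part.
suff : mu (~` free_part) = 0%E.
  move/(congr1 fine); rewrite -/(P _) probC//=; lra.
pose N n := \bigcup_(g in [set g | g <> 1%g /\ c g = n]) [set x | act g x = act 1%g x].
have N0 n : mu.-negligible (N n).
  case: (pselect (exists2 g, g <> 1%g & c g = n)) => [[g g1 cg]|nex].
    exists [set x | act g x = act 1%g x]; split; first exact: measurable_act_eq.
      rewrite -(free g g1); congr (mu _); apply: funext => x.
      by rewrite /= act_action.1.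
    by move=> x [h [_]]; rewrite -cg => /c_inj ->.
  exists set0; split=> // x [h [h1 ch]] _; apply: nex; by exists h.
apply/negligibleP; first exact: measurableC.
apply: negligibleS (negligible_bigcup N0); rewrite free_partE => x [g g1 gx].
by exists (c g) => //; exists g.
Qed.

(** * From small boundaries to an invariant mean *)

(* [m B] is the probability that the least point of the class of [x], in a
   fixed Borel order, is [g x] with [g] in [B]. *)
Lemma approximate_mean (theta : set (X * X)) :
  essentially_free mu act ->
  subequivalence act theta ->
  (forall x, finite_set (rel_class theta x)) ->
  exists m : set G -> R, [/\ forall B, 0 <= m B <= 1, m setT = 1,
    finitely_additive m & forall s B, S s ->
      `|m [set (b * s)%g | b in B] - m B| <= P (boundary act S theta)].
Proof.
move=> free [mt t_orb [t_refl t_sym t_trans]] t_fin.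
pose M g := [set x | theta (x, act g x) /\
  forall h, theta (x, act h x) -> ~ lexi_lt A (act h x) (act g x)].
have mM g : measurable (M g).
  rewrite (_ : M g = [set x | theta (x, act g x)] `&` \bigcap_h
      (~` ([set x | theta (x, act h x)] `&`
           [set x | lexi_lt A (act h x) (act g x)]))).
    apply: measurableI; first exact: measurable_rel.
    apply: countable_bigcap_measurable => // h _; apply/measurableC/measurableI.
      exact: measurable_rel.
    exact: measurable_lexi_lt.
  apply/seteqP; split=> x [xg]; first by move=> H; split=> // h _ [/H].
  by move=> H; split=> // h xh lt; apply: (H h).
have M_inj x g h : free_part x -> M g x -> M h x -> g = h.
  move=> fx [xg gmin] [xh hmin]; apply: (free_part_inj fx).
  by apply: contrapT => /(lexi_lt_total sepA)[]; [exact: hmin|exact: gmin].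
have M_ex x : exists g, M g x.
  have [|y xy ymin] := lexi_min A (t_fin x); first by exists x; exact: t_refl.
  have [g /= gy] := t_orb _ xy; exists g; split; first by rewrite -gy.
  by move=> h xh; rewrite -gy; exact: ymin.
(* If [x] and [s x] share a class, they select the same point: [(g s) x] seen from [x] is [g (s x)]
   seen from [s x]. *)
have M_shift x g s : theta (x, act s x) -> M (g * s)%g x <-> M g (act s x).
  move=> xs; split=> -[xg gmin]; split.
  - by apply: t_trans (t_sym _ _ xs) _; rewrite -act_action.2.
  - move=> h xh; rewrite -!act_action.2; apply: gmin.
    by rewrite act_action.2; exact: t_trans xh.
  - by rewrite act_action.2; exact: t_trans xg.
  - move=> h xh; rewrite act_action.2; have := gmin (h * s^-1)%g.
    rewrite -act_action.2 -mulgA mulVg mulg1; apply.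
    exact: t_trans (t_sym _ _ xs) xh.
(* Off the free part several [g] may select the same point; restricting to it makes the events [M g]
   disjoint. *)
pose W B := free_part `&` \bigcup_(g in B) M g.
have mW B : measurable (W B).
  apply: measurableI; first exact: measurable_free_part.
  exact: countable_bigcup_measurable.
exists (P \o W); split=> /=.
- by move=> B; rewrite prob_ge0 prob_le1.
- rewrite -(prob_free_part free); congr prob; apply/seteqP; split=> [x []//|x fx].
  by split=> //; have [g] := M_ex x; exists g.
- move=> B C BC; rewrite -probU//.
    by congr prob; rewrite /W bigcup_setU setIUr.
  apply/seteqP; split=> // x [[fx [g Bg gx]] [_ [h Ch hx]]].
  rewrite -(M_inj x g h fx gx hx) in Ch.
  by have : (B `&` C) g by []; rewrite BC.
move=> s B Ss; rewrite -(prob_act s (mW B)); set D := boundary _ _ _.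
have mD : measurable D by exact: measurable_boundary.
have mWs : measurable (act s @^-1` W B) by exact: measurable_act_preimage.
have ND x : ~ D x -> theta (x, act s x).
  by move=> Dx; apply: contrapT => xs; apply: Dx; exists s.
(* [W (B s)] and the preimage of [W B] under [s] agree outside [D], and that preimage has the
   measure of [W B]. *)
have h1 : W [set (b * s)%g | b in B] `<=` act s @^-1` W B `|` D.
  move=> x [fx [_ [b Bb <-] bx]].
  case: (pselect (D x)) => [Dx|/ND xs]; [by right|left].
  split; first exact: free_part_act.
  by exists b => //; rewrite -M_shift.
have h2 : act s @^-1` W B `<=` W [set (b * s)%g | b in B] `|` D.
  move=> x [fx [b Bb bx]].
  case: (pselect (D x)) => [Dx|/ND xs]; [by right|left].
  split; first by have := free_part_act (g := s^-1%g) fx; rewrite actK.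
  by exists (b * s)%g; [exists b|rewrite M_shift].
have := le_trans (le_prob mu (mW _) (measurableU _ _ mWs mD) h1)
                 (probU_le mu mWs mD).
have := le_trans (le_prob mu mWs (measurableU _ _ (mW _) mD) h2)
                 (probU_le mu (mW _) mD).
rewrite ler_norml; lra.
Qed.

Lemma classes_le_finite (theta : set (X * X)) n :
  classes_le theta n -> forall x, finite_set (rel_class theta x).
Proof. by move=> tn x; exact: card_le_finite (tn x) (finite_II n). Qed.

Lemma amenable_of_isoperimetric_profile :
  generates S -> essentially_free mu act ->
  isoperimetric_profile mu act S n @[n --> \oo] --> 0%E -> amenable R G.
Proof.
move=> gS free cvg0.
have /choice[m mP] n : exists m : set G -> R,
    [/\ forall B, 0 <= m B <= 1, m setT = 1,
    finitely_additive m & forall s B, S s ->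
      `|m [set (b * s)%g | b in B] - m B| <= n.+1%:R^-1].
  have [k kn] : exists k, (isoperimetric_profile mu act S k < n.+1%:R^-1%:E)%E.
    have /fine_cvgP[fin_p fine_p] := cvg0.
    have n0 : (0 : R) < n.+1%:R^-1 by rewrite invr_gt0.
    near \oo => k; exists k; rewrite -[ltLHS]fineK ?lte_fin; last by near: k.
    by near: k; exact: cvgr_lt fine_p _ n0.
  have [_ [theta [st tk] <-] lt] := ereal_inf_lt kn.
  have [m [m01 m1 mD mS]] := approximate_mean free st (classes_le_finite tk).
  exists m; split=> // s B Ss; apply: le_trans (mS s B Ss) _.
  rewrite -lee_fin -probE ?ltW//; apply: measurable_boundary.
  by case: st.
(* [U] contains all cofinal segments, so the errors [1/(n+1)] vanish along [U]. *)
have [U [UU leU]] := ultrafilter_nat.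
have /choice[l lP] B : exists l : R, m n B @[n --> U] --> l.
  by apply: ultralimit_exists => n; have [] := mP n.
have UP : ProperFilter U by exact: ultra_proper.
have l_eq B C (u : nat -> R) : u n @[n --> U] --> 0 ->
    (forall n, `|m n B - m n C| <= u n) -> l B = l C.
  move=> u0 le; apply/eqP; rewrite -subr_eq0; apply/eqP.
  apply: (@cvg_unique _ _ (m n B - m n C @[n --> U])) => //.
    exact: cvgB.
  apply: norm_cvg0; apply: (@squeeze_cvgr _ U _ _ (fun=> 0) u) => //.
    by apply: filterE => n; rewrite normr_ge0 le.
  exact: cvg_cst.
have invS s B : S s -> l [set (b * s)%g | b in B] = l B.
  move=> Ss; apply: (l_eq _ _ (fun n => n.+1%:R^-1)).
    exact: cvg_trans (cvg_app _ leU) cvg_harmonic.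
  by move=> n; have [_ _ _] := mP n; apply.
(* The elements whose right translation preserves [l] form a subgroup, and it contains [S]. *)
have inv g B : l [set (b * g)%g | b in B] = l B.
  have imM h k (C : set G) : [set (b * (h * k))%g | b in C] =
      [set (b * k)%g | b in [set (b * h)%g | b in C]].
    apply/seteqP; split=> [_ [b Cb <-]|_ [_ [b Cb <-] <-]].
      by exists (b * h)%g; [exists b|rewrite mulgA].
    by exists b; rewrite ?mulgA.
  have im1 (C : set G) : [set (b * 1)%g | b in C] = C.
    apply/seteqP; split=> [_ [b Cb <-]|b Cb]; first by rewrite mulg1.
    by exists b; rewrite ?mulg1.
  apply: (@generates_subgroup _ S
    [set g | forall B, l [set (b * g)%g | b in B] = l B]) => //.
  - split=> [C|h k hl kl C|h hl C]; first by rewrite im1.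
    + by rewrite imM kl hl.
    + by rewrite -hl -imM mulVg im1.
  - by move=> s Ss C; exact: invS.
(* Inversion swaps the sides: the inverse of [g B] is the inverse of [B] multiplied by [g^-1] on the
   right. *)
exists (fun B => l [set b^-1%g | b in B]); split=> /=.
- move=> B; rewrite -(cvg_lim (@Rhausdorff R) (lP _)); apply: limr_ge.
    by apply/cvg_ex; eexists; exact: lP.
  by apply: filterE => n; have [/(_ [set b^-1%g | b in B])/andP[]] := mP n.
- have -> : [set b^-1%g | b in [set: G]] = [set: G].
    by apply/seteqP; split=> // g _; exists g^-1%g; rewrite ?invgK.
  apply: (cvg_unique _ (lP setT)) => //.
  rewrite (_ : m^~ setT = fun=> 1); first exact: cvg_cst.
  by apply: funext => n; have [_ m1 _ _] := mP n.
- move=> B C BC; rewrite image_setU.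
  apply: (cvg_unique _ (lP _)) => //.
  rewrite (_ : (fun n => _) = fun n =>
      m n [set b^-1%g | b in B] + m n [set b^-1%g | b in C]).
    by apply: cvgD; exact: lP.
  apply: funext => n; have [_ _ mD _] := mP n; rewrite mD//.
  apply/seteqP; split=> // _ [[b Bb <-] [c' Cc /invg_inj cb]].
  by rewrite cb in Cc; have : (B `&` C) b by []; rewrite BC.
move=> g B; rewrite -[RHS](inv g^-1%g); congr l.
apply/seteqP; split=> [_ [_ [b Bb <-] <-]|_ [_ [b Bb <-] <-]].
  by exists b^-1%g; [exists b|rewrite invgM].
by exists (g * b)%g; [exists b|rewrite invgM].
Unshelve. all: by end_near.
Qed.

(** * Disjoint translates and the cutting of large classes *)

(** For one [g <> 1], almost every [x] lies in some [A n] that misses [g x]; one of these countably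
    many pieces of [C] keeps positive measure. The property passes to subsets, so the elements of
    [K] are treated in turn. *)
Lemma disjoint_translates (K : seq G) (C : set X) :
  essentially_free mu act -> 1%g \notin K -> measurable C -> 0 < P C ->
  exists C', [/\ C' `<=` C, measurable C', 0 < P C' &
    forall g x, g \in K -> C' x -> ~ C' (act g x)].
Proof.
move=> free; elim: K C => [|g K IH] C; first by move=> _ mC C0; exists C; split.
rewrite inE negb_or eq_sym => /andP[/eqP g1 K1] mC C0.
have [C' [C'C mC' C'0 C'K]] := IH C K1 mC C0.
pose U n := C' `&` (A n `&` ~` (act g @^-1` A n)).
have mU n : measurable (U n).
  apply: measurableI => //; apply: measurableI => //.
  exact/measurableC/measurable_act_preimage.
have C'U : C' `<=` \bigcup_n U n `|` [set x | act g x = act 1%g x].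
  move=> x C'x; case: (pselect (act g x = x)) => gx.
    by right; rewrite /= gx act_action.1.
  by left; have [n [Ax Agx]] := sepA (nesym gx); exists n.
have [n Un] : exists n, 0 < P (U n).
  apply: prob_bigcup_gt0 => //; apply: lt_le_trans C'0 _.
  have mUU : measurable (\bigcup_n U n) by exact: bigcup_measurable.
  apply: le_trans (le_prob mu mC' _ C'U) _.
    by apply: measurableU => //; exact: measurable_act_eq.
  apply: le_trans (probU_le _ _ _) _ => //; first exact: measurable_act_eq.
  have := free g g1.
  rewrite (_ : [set x | act g x = x] = [set x | act g x = act 1%g x]).
    by rewrite {2}/prob => ->; rewrite addr0.
  by apply: funext => x; rewrite /= act_action.1.
exists (U n); split=> //; first by move=> x [/C'C].
move=> h x; rewrite inE => /predU1P[->|hK] [C'x [Ax Agx]] [C'hx [Ahx _]] //.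
exact: C'K C'x C'hx.
Qed.

(** The points whose class is reached by group elements of code below [n] form sets [Z n] increasing
    to [X]. Keeping [theta] inside [Z n] and making it trivial elsewhere only harms points [x] for
    which [x] or some [s x] lies outside [Z n]. *)
Lemma bounded_subequivalence (theta : set (X * X)) (e : R) :
  subequivalence act theta -> (forall x, finite_set (rel_class theta x)) ->
  0 < e -> exists n theta', [/\ subequivalence act theta',
    classes_le theta' n &
    P (boundary act S theta') <= P (boundary act S theta) + e].
Proof.
move=> [mt t_orb [t_refl t_sym t_trans]] t_fin e0.
have [c c_inj] := code_exists.
pose Z n := [set x | forall g, theta (x, act g x) ->
  exists2 h, (c h < n)%N & act g x = act h x].
have mZ n : measurable (Z n).
  rewrite (_ : Z n = \bigcap_g (~` [set x | theta (x, act g x)] `|`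
      \bigcup_(h in [set h | (c h < n)%N]) [set x | act g x = act h x])).
    apply: countable_bigcap_measurable => // g _; apply: measurableU.
      exact/measurableC/measurable_rel.
    by apply: countable_bigcup_measurable => // h _; exact: measurable_act_eq.
  apply/seteqP; split=> x Zx g.
    move=> _; case: (pselect (theta (x, act g x))) => xg; last by left.
    by right; have [h hn xh] := Zx g xg; exists h.
  by move=> xg; have [//|[h hn xh]] := Zx g Logic.I; exists h.
have incZ n : Z n `<=` Z n.+1.
  by move=> x Zx g /Zx[h hn xh]; exists h => //; rewrite ltnW.
have ZT : \bigcup_n Z n = setT.
  apply/seteqP; split=> // x _; have /finite_seqP[s sE] := t_fin x.
  have /choice[h hP] y : exists h, theta (x, y) -> y = act h x.
    case: (pselect (theta (x, y))) => [xy|]; last by exists 1%g.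
    by have [h] := t_orb _ xy; exists h.
  exists (\max_(y <- s) c (h y)).+1 => // g xg.
  exists (h (act g x)); last exact: hP.
  rewrite ltnS; apply: (@leq_bigmax_seq _ s xpredT (fun y => c (h y))) => //.
  by have : rel_class theta x (act g x) by []; rewrite sE.
(* One copy of the complement of [Z n] for [x] itself and one for each [s x]. *)
pose q := (#|` fset_set S|.+1)%:R : R.
have [n Zn] : exists n, q * P (~` Z n) <= e.
  have := prob_bigcup_cvg (mu := mu) mZ incZ; rewrite ZT probT => cZ.
  have eq0 : 1 - e / q < 1 by rewrite ltrBlDr ltrDl divr_gt0.
  near \oo => n; exists n; rewrite probC// mulrC -ler_pdivlMr//.
  rewrite lerBlDl -lerBlDr ltW//; near: n.
  exact: cvgr_gt cZ _ eq0.
pose theta' := [set p | p.1 = p.2] `|` (theta `&` [set p | Z n p.1 /\ Z n p.2]).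
have mfst : measurable_fun setT (fst : X * X -> X) by exact: measurable_fst.
have msnd : measurable_fun setT (snd : X * X -> X) by exact: measurable_snd.
have mt' : measurable theta'.
  apply: measurableU; first exact: (measurable_eq mA sepA).
  apply: measurableI => //.
  by apply: measurableI; [exact: measurable_preimage|exact: measurable_preimage].
(* [n.+1] instead of [n] leaves room for the trivial classes when [n = 0]. *)
exists n.+1, theta'; split.
- split=> //.
    move=> [x y] [/= ->|[/t_orb//]].
    by exists 1%g; rewrite /= act_action.1.
  split=> [x|x y|x y z]; first by left.
    by case=> [/= ->|[/t_sym yx [Zx Zy]]]; [left|right].
  case=> [/= -> //|[xy [Zx Zy]]] [/= <-|[yz [_ Zz]]]; right; split=> //.
  exact: t_trans yz.
- move=> x; case: (pselect (Z n x)) => Zx; last first.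
    apply: (@card_le_trans _ _ _ `I_1); last by rewrite card_le_II.
    apply: (@card_le_trans _ _ _ [set x]).
      by apply: subset_card_le => y [/= ->|[_ []]].
    by have /card_eqPle[] := @card_set1 _ x.
  apply: (@card_le_trans _ _ _ (act^~ x @` [set h | (c h < n.+1)%N])).
    apply: subset_card_le => y xy.
    have {}xy : theta (x, y) by case: xy => [/= ->|[]].
    have [g gy] := t_orb _ xy; rewrite /= in gy.
    have [h hn xh] : exists2 h, (c h < n)%N & act g x = act h x.
      by apply: Zx; rewrite -gy.
    by exists h; [rewrite /= ltnW|rewrite gy].
  apply: card_le_trans (card_image_le _ _) _.
  have /card_eqPle[_] := @inj_card_eq _ _ [set h | (c h < n.+1)%N] c
    (in2W c_inj).
  move=> /card_le_trans; apply.
  by apply: subset_card_le => _ [h hn <-].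
have mZC g : measurable (act g @^-1` ~` Z n).
  exact/measurable_act_preimage/measurableC.
have mb := measurable_boundary mt.
have mU : measurable (\big[setU/set0]_(s <- fset_set S) (act s @^-1` ~` Z n)).
  exact: bigsetU_measurable.
have sub : boundary act S theta' `<=` boundary act S theta `|`
    (~` Z n `|` \big[setU/set0]_(s <- fset_set S) (act s @^-1` ~` Z n)).
  move=> x [s Ss xs].
  case: (pselect (Z n x)) => Zx; last by right; left.
  case: (pselect (Z n (act s x))) => Zsx.
    by left; exists s => // xs'; apply: xs; right.
  right; right; rewrite -bigcup_seq; exists s => //=.
  by rewrite in_fset_set// inE.
have mZn := measurableC (mZ n).
apply: le_trans (le_prob mu (measurable_boundary mt') _ sub) _.
  by apply: measurableU => //; exact: measurableU.
apply: le_trans (probU_le mu mb (measurableU _ _ mZn mU)) _.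
rewrite lerD2l; apply: le_trans Zn; apply: le_trans (probU_le mu mZn mU) _.
rewrite /q -natr1 mulrDl mul1r addrC lerD2r.
apply: le_trans (prob_bigsetU_le _ _ _) _ => //.
under eq_bigr do rewrite prob_act//.
rewrite big_const_seq count_predT iter_addr_0 mulr_natl.
by [].
Unshelve. all: by end_near.
Qed.

(** * Tilings and their increasing limits *)

(* A tiling is a relation which is trivial outside a set [t.2]. Only the edges
   touching [t.2] are charged to it, so that new tiles placed outside [t.2] only
   have to pay for edges inside [~` t.2]. *)
Definition tiling_boundary_set (t : set (X * X) * set X) : set X :=
  [set x | exists2 s, S s & (t.2 x \/ t.2 (act s x)) /\ ~ t.1 (x, act s x)].

Record is_tiling (e : R) (t : set (X * X) * set X) : Prop := IsTiling {
  tiling_support : measurable t.2;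
  tiling_subequivalence : subequivalence act t.1;
  tiling_finite : forall x, finite_set (rel_class t.1 x);
  tiling_trivial : forall x y, t.1 (x, y) -> x = y \/ t.2 x /\ t.2 y;
  tiling_boundary : P (tiling_boundary_set t) <= e * P t.2 }.

Lemma measurable_tiling_boundary t : measurable t.1 -> measurable t.2 ->
  measurable (tiling_boundary_set t).
Proof.
move=> m1 m2; rewrite (_ : tiling_boundary_set t = \bigcup_(s in S)
    ((t.2 `|` act s @^-1` t.2) `&` ~` [set x | t.1 (x, act s x)])).
  apply: countable_bigcup_measurable => // s _; apply: measurableI.
    by apply: measurableU => //; exact: measurable_act_preimage.
  exact/measurableC/measurable_rel.
by apply/seteqP; split=> x [s Ss [? ?]]; exists s.
Qed.

(** Classes of points of the old support are frozen. Hence an edge once charged stays charged, and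
    the boundary sets increase along a chain. *)
Definition tiling_le (t u : set (X * X) * set X) : Prop :=
  t.2 `<=` u.2 /\ forall x y, t.2 x -> t.1 (x, y) <-> u.1 (x, y).

Lemma tiling_le_refl t : tiling_le t t.
Proof. by split. Qed.

Lemma tiling_le_trans t u v : tiling_le t u -> tiling_le u v -> tiling_le t v.
Proof.
move=> [tu tuE] [uv uvE]; split; first exact: subset_trans uv.
by move=> x y tx; rewrite tuE// uvE//; exact: tu.
Qed.

Lemma tiling_le_sub e t u : is_tiling e t -> is_tiling e u -> tiling_le t u ->
  t.1 `<=` u.1.
Proof.
move=> Tt Tu [tu tuE] [x y] xy.
have [_ _ [u_refl _ _]] := tiling_subequivalence Tu.
by have [->|[tx _]] := tiling_trivial Tt xy => //; apply/tuE.
Qed.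

(** Take the unions of relations and of supports. A point has its final class as soon as it enters
    the support, so classes stay finite; the boundary bound passes to the limit by continuity of the
    measure. *)
Lemma tiling_chain e (t : nat -> set (X * X) * set X) : 0 <= e ->
  (forall n, is_tiling e (t n)) -> (forall n, tiling_le (t n) (t n.+1)) ->
  exists2 u, is_tiling e u & forall n, tiling_le (t n) u.
Proof.
move=> e0 Tt t_inc.
have t_le m n : (m <= n)%N -> tiling_le (t m) (t n).
  elim: n => [|n IH]; first by rewrite leqn0 => /eqP ->; exact: tiling_le_refl.
  rewrite leq_eqVlt => /predU1P[->|mn]; first exact: tiling_le_refl.
  exact: tiling_le_trans (IH mn) (t_inc n).
have t_sub m n : (m <= n)%N -> (t m).1 `<=` (t n).1.
  by move=> /t_le; exact: tiling_le_sub.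
pose u : set (X * X) * set X := (\bigcup_n (t n).1, \bigcup_n (t n).2).
have tu n : tiling_le (t n) u.
  split=> [x tx|x y tx]; first by exists n.
  split=> [xy|[m _ xy]]; first by exists n.
  apply/(t_le n (maxn m n) (leq_maxr _ _)).2 => //.
  exact: (t_sub m _ (leq_maxl _ _)).
have mt n : measurable (t n).1 by have [] := tiling_subequivalence (Tt n).
have mu2 : measurable u.2.
  by apply: bigcup_measurable => n _; exact: tiling_support (Tt n).
have mu1 : measurable u.1 by exact: bigcup_measurable.
exists u => //; split=> //.
- split=> //.
    by move=> p [n _]; have [_ + _] := tiling_subequivalence (Tt n); apply.
  split=> [x|x y [n _ xy]|x y z [n _ xy] [m _ yz]].
  + by exists 0%N => //; have [_ _ [+ _ _]] := tiling_subequivalence (Tt 0%N); apply.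
  + by exists n => //; have [_ _ [_ + _]] := tiling_subequivalence (Tt n); apply.
  + exists (maxn n m) => //.
    have [_ _ [_ _ +]] := tiling_subequivalence (Tt (maxn n m)); apply.
      exact: (t_sub n _ (leq_maxl _ _)) xy.
    exact: (t_sub m _ (leq_maxr _ _)) yz.
- move=> x; case: (pselect (u.2 x)) => [[n _ tx]|nux].
    apply: sub_finite_set (tiling_finite (Tt n) x) => y xy.
    exact/(tu n).2.
  apply: (@sub_finite_set _ _ [set x]) => // y [n _ xy].
  by have [//|[tx _]] := tiling_trivial (Tt n) xy; case: nux; exists n.
- move=> x y [n _ xy]; have [->|[tx ty]] := tiling_trivial (Tt n) xy; first by left.
  by right; split; exists n.
have mb n : measurable (tiling_boundary_set (t n)).
  by apply: measurable_tiling_boundary => //; exact: tiling_support (Tt n).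
apply: (@le_trans _ _ (P (\bigcup_n tiling_boundary_set (t n)))).
  apply: le_prob.
  - exact: measurable_tiling_boundary.
  - exact: bigcup_measurable.
  move=> x [s Ss [xB xs]].
  have [n nB] : exists n, (t n).2 x \/ (t n).2 (act s x).
    by case: xB => -[n _ nB]; exists n; [left|right].
  by exists n => //; exists s => //; split=> // xs'; apply: xs; exists n.
apply: prob_bigcup_le => // n.
  move=> x [s Ss [xB xs]]; exists s => //; split.
    by case: xB => /(t_inc n).1; [left|right].
  have [_ _ [_ t_sym _]] := tiling_subequivalence (Tt n).
  have [_ _ [_ t_sym' _]] := tiling_subequivalence (Tt n.+1).
  case: xB => xB xs'; apply: xs; first exact/(t_inc n).2.
  by apply: t_sym; apply/(t_inc n).2 => //; exact: t_sym'.
apply: le_trans (tiling_boundary (Tt n)) _; apply: ler_wpM2l => //.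
by apply: le_prob => //; [exact: tiling_support (Tt n)|exact: (tu n).1].
Qed.

(** * Extending a tiling by a family of disjoint tiles *)

Section tiling_extension.
Context (e : R) (theta : set (X * X)) (B : set X) (F : {fset G}) (C : set X).
Context (e_ge0 : 0 <= e) (T : is_tiling e (theta, B)) (sym_S : symmetric_set S)
        (mC : measurable C)
        (C_disj : forall f g x, f \in F -> g \in F ->
           C x -> C (act (g^-1 * f)%g x) -> f = g).

Let Y := ~` B.
Let E := leaving (fset_set S) F.
Let U f := act f @^-1` Y.
Let V (p : G * G) := act p.2 @^-1` Y `&` act (p.1 * p.2)%g @^-1` Y.

(** [C_disj] makes the sets [F x], [x] in [C], pairwise disjoint. [C_hits] says that few edges
    inside [Y] leave [F x], relative to the points of [F x] in [Y]; the factor 2 pays for both ends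
    of an edge. *)
Context (C_hits : forall x, C x -> 2 * hits E V x < e * hits F U x)
        (C_gt0 : 0 < P C).

Let mB : measurable B := tiling_support T.
Let mY : measurable Y := measurableC mB.
Let mU f : measurable (U f).
Proof. exact: measurable_act_preimage. Qed.
Let mV p : measurable (V p).
Proof. by apply: measurableI; exact: measurable_act_preimage. Qed.

(** An equivalence relation on the new support only: its classes are the nonempty sets [F x] minus
    [B], for [x] in [C]. *)
Definition tile_rel : set (X * X) := [set p | exists f g x,
  [/\ f \in F, g \in F, C x, p.1 = act f x & p.2 = act g x] /\
  (~ B p.1 /\ ~ B p.2)].

Definition tile_support : set X :=
  \big[setU/set0]_(f <- F) (act f @` (C `&` act f @^-1` ~` B)).

Let tile_supportP y :
  tile_support y <-> ~ B y /\ exists2 f, f \in F & exists2 x, C x & y = act f x.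
Proof.
rewrite /tile_support -bigcup_seq; split.
  by move=> [f /= fF [x [Cx Yx] <-]]; split=> //; exists f => //; exists x.
move=> [By [f fF [x Cx yE]]]; exists f => //; exists x; rewrite -?yE//.
by split=> //=; rewrite -yE.
Qed.

Let tile_inj f g x y : f \in F -> g \in F -> C x -> C y ->
  act f x = act g y -> f = g /\ x = y.
Proof.
move=> fF gF Cx Cy /(congr1 (act g^-1%g)); rewrite actK -act_action.2 => xy.
have fg : f = g by apply: (C_disj fF gF Cx); rewrite xy.
by split=> //; rewrite -xy fg mulVg act_action.1.
Qed.

Let mimg g (D : set X) : measurable D -> measurable (act g @` D).
Proof. by move=> mD; rewrite act_imageE; exact: measurable_act_preimage. Qed.

Let prob_img g (D : set X) : measurable D -> P (act g @` D) = P D.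
Proof. by move=> mD; rewrite act_imageE prob_act. Qed.

Let mCU f : measurable (C `&` U f).
Proof. exact: measurableI. Qed.

Let mTS : measurable tile_support.
Proof. by apply: bigsetU_measurable => f _; exact/mimg/mCU. Qed.

Let prob_tile_support : P tile_support = \sum_(f <- F) P (C `&` U f).
Proof.
rewrite /tile_support prob_bigsetU//.
- by apply: eq_bigr => f _; rewrite prob_img//; exact: mCU.
- by move=> f; exact/mimg/mCU.
move=> f g y fF gF [x [Cx _] <-] [x' [Cx' _]] /esym.
by move=> /(tile_inj fF gF Cx Cx')[].
Qed.

(** The strict inequality in [C_hits] forces [F x] to meet [Y] for every [x] in [C], so the sets [C]
    intersected with [U f] cover [C]. *)
Let tile_support_gt0 : 0 < P tile_support.
Proof.
apply: lt_le_trans C_gt0 _; rewrite prob_tile_support.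
apply: le_trans (prob_bigsetU_le mu F mCU); apply: le_prob => //.
  by apply: bigsetU_measurable => f _; exact: mCU.
move=> x Cx; rewrite -bigcup_seq; apply: contrapT => nUx.
have := C_hits Cx; rewrite [X in e * X]big1_seq ?mulr0 => [|f /= fF].
  by apply/negP; rewrite -leNgt mulr_ge0// hits_ge0.
rewrite indicE; case: (boolP (x \in U f)) => // /set_mem Ux.
by case: nUx; exists f.
Qed.

(** For fixed [f] and [g] the base point can be eliminated: what remains is the graph of [g f^-1]
    over the image of [C] under [f], cut down to [Y]. *)
Let measurable_tile_rel : measurable tile_rel.
Proof.
have mfst : measurable_fun setT (fst : X * X -> X) by exact: measurable_fst.
have msnd : measurable_fun setT (snd : X * X -> X) by exact: measurable_snd.
rewrite (_ : tile_rel = \bigcup_(f in [set` F]) \bigcup_(g in [set` F])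
    ((fst @^-1` (act f @` C `&` Y) `&` snd @^-1` Y) `&`
     [set p | p.2 = act (g * f^-1)%g p.1])).
  apply: countable_bigcup_measurable => // f _.
  apply: countable_bigcup_measurable => // g _.
  apply: measurableI.
    apply: measurableI; apply: measurable_preimage => //.
    by apply: measurableI => //; exact: mimg.
  apply: (measurable_eq mA sepA) => //.
  by apply: measurableT_comp => //; exact: measurable_act.
apply/seteqP; split=> [[y z] /=|[y z]].
  move=> [f [g [x [[fF gF Cx /= yE zE] [yB zB]]]]]; exists f => //; exists g => //=.
  split; first by do 2!split => //; exists x.
  by rewrite yE zE act_action.2 actK.
move=> [f fF [g gF [[/= [[x Cx xy] yB] zB] zE]]].
exists f, g, x; split=> //; split=> //=.
by rewrite zE -xy act_action.2 actK.
Qed.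

Let theta_id x y : theta (x, y) -> ~ B x -> x = y.
Proof. by move=> /(tiling_trivial T)[//|[]]. Qed.

Let theta_id' x y : theta (x, y) -> ~ B y -> x = y.
Proof. by move=> /(tiling_trivial T)[//|[]]. Qed.

Lemma tiling_extend :
  [/\ is_tiling e (theta `|` tile_rel, B `|` tile_support),
      tiling_le (theta, B) (theta `|` tile_rel, B `|` tile_support) &
      P B < P (B `|` tile_support)].
Proof.
have [mt t_orb [t_refl t_sym t_trans]] := tiling_subequivalence T.
have PBT : P (B `|` tile_support) = P B + P tile_support.
  by rewrite probU//; apply/seteqP; split=> // x [Bx /tile_supportP[]].
split; last by rewrite PBT ltrDl.
  split=> /=.
  - exact: measurableU.
  - split; first exact: measurableU.
      move=> [y z] [/t_orb//|[f [g [x [[fF gF Cx /= yE zE] _]]]]].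
      by exists (g * f^-1)%g; rewrite yE zE act_action.2 actK.
    split=> [x|x y|x y z]; first by left; exact: t_refl.
      case=> [/t_sym ?|[f [g [w [[fF gF Cx yE zE] [? ?]]]]]]; first by left.
      by right; exists g, f, w.
    (* In the mixed cases the [theta] step touches a point outside [B] and is trivial; two tile
       steps lie in the same tile by [tile_inj]. *)
    case=> [xy|xy] [yz|yz].
    + by left; exact: t_trans yz.
    + have [_ [_ [_ [_ [yB _]]]]] := yz; right.
      by rewrite (theta_id' xy).
    + have [_ [_ [_ [_ [_ yB]]]]] := xy; right.
      by rewrite -(theta_id yz).
    + move: xy yz => [f [g [w [[fF gF Cw /= xE yE] [xB yB]]]]].
      move=> [f' [g' [w' [[f'F g'F Cw' /= yE' zE] [_ zB]]]]]; right.
      have [_ ww'] : g = f' /\ w = w'.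
        by apply: tile_inj => //; rewrite -yE.
      rewrite -ww' in zE.
      by exists f, g', w; split=> //; split.
  - move=> x; have fin1 := tiling_finite T x.
    pose K := [set` [fset (g * f^-1)%g | g in F, f in F]%fset].
    have fin2 : finite_set (act^~ x @` K) by apply: finite_image; exact: finite_fset.
    have : finite_set (rel_class theta x `|` act^~ x @` K) by rewrite finite_setU.
    apply: sub_finite_set => y [xy|]; first by left.
    move=> [f [g [w [[fF gF Cw /= xE yE] _]]]]; right.
    exists (g * f^-1)%g; last by rewrite xE yE act_action.2 actK.
    by rewrite /K /=; apply/imfset2P; exists g => //; exists f.
  - move=> x y [/(tiling_trivial T)[->|[Bx By]]|]; first by left.
      by right; split; left.
    move=> [f [g [w [[fF gF Cw /= xE yE] [xB yB]]]]]; right.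
    split; right; apply/tile_supportP; split=> //.
      by exists f => //; exists w.
    by exists g => //; exists w.
  (* Both ends of every edge inside [Y] that leaves a tile. *)
  pose D : set X := \big[setU/set0]_(p <- E)
    (act p.2 @` (C `&` V p) `|` act (p.1 * p.2)%g @` (C `&` V p)).
  have mCV p : measurable (C `&` V p) by exact: measurableI.
  have mD1 p : measurable
      (act p.2 @` (C `&` V p) `|` act (p.1 * p.2)%g @` (C `&` V p)).
    by apply: measurableU; exact: mimg.
  have mD : measurable D by exact: bigsetU_measurable.
  have PD : P D <= 2 * \sum_(p <- E) P (C `&` V p).
    apply: le_trans (prob_bigsetU_le _ _ mD1) _.
    rewrite mulr_sumr; apply: ler_sum => p _.
    apply: le_trans (probU_le _ (mimg _ (mCV p)) (mimg _ (mCV p))) _.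
    by rewrite !prob_img//; lra.
  have PV : 2 * \sum_(p <- E) P (C `&` V p) <= e * \sum_(f <- F) P (C `&` U f).
    by apply: le_sum_prob => // x /C_hits/ltW.
  have mD0 := measurable_tiling_boundary mt mB.
  rewrite PBT mulrDr prob_tile_support.
  apply: le_trans (lerD (tiling_boundary T) (le_trans PD PV)).
  apply: le_trans (probU_le _ mD0 mD); apply: le_prob.
  - by apply: measurable_tiling_boundary; exact: measurableU.
  - exact: measurableU.
  move=> x [s Ss [xB /not_orP[/= xs xs']]].
  case: (pselect (B x)) => Bx; first by left; exists s => //; split=> //; left.
  case: (pselect (B (act s x))) => Bsx; first by left; exists s => //; split=> //; right.
  (* An edge touching [B] is charged to the old tiling. Otherwise one of its ends lies in a new
     tile, which the edge leaves. *)
  right; rewrite /D -bigcup_seq; case: xB => -[//|/tile_supportP[_ [f fF [w Cw xE]]]].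
    exists (s, f) => /=.
      apply/leavingP; split=> //; first by rewrite in_fset_set// inE.
      apply/negP => sfF; apply: xs'; exists f, (s * f)%g, w.
      by split=> //; split=> //=; rewrite xE act_action.2.
    left; exists w => //; split=> //; split => /=; first by rewrite -xE.
    by rewrite act_action.2 -xE.
  (* Here the tile contains [s x]; reversed, the edge leaves it with label [s^-1], which lies in [S]
     by symmetry. *)
  have xE' : x = act (s^-1 * f)%g w by rewrite act_action.2 -xE actK.
  exists (s^-1, f)%g => /=.
    apply/leavingP; split=> //; first by rewrite in_fset_set// inE; exact: sym_S.
    apply/negP => sfF; apply: xs'; exists (s^-1 * f)%g, f, w.
    by split=> //; split=> //=; rewrite xE' ?act_action.2 -?xE.
  right; exists w => //; split=> //; split => /=; first by rewrite -xE.
  by rewrite -xE'.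
split=> [x Bx|x y Bx]; first by left.
split=> [xy|[//|]]; first by left.
by move=> [f [g [w [_ []]]]].
Qed.

End tiling_extension.

Lemma tiling_improve (e : R) (t : set (X * X) * set X) :
  symmetric_set S -> essentially_free mu act -> amenable R G -> 0 < e ->
  is_tiling e t -> P t.2 < 1 ->
  exists2 u, is_tiling e u & tiling_le t u /\ P t.2 < P u.2.
Proof.
case: t => theta B symS free amG e0 T /= PB.
have [c c_inj] := code_exists.
have mB : measurable B := tiling_support T.
have mY := measurableC mB.
have PY : 0 < P (~` B) by rewrite probC// subr_gt0.
(* The 4 rules out a null [C0]: with [Y] the complement of [B], integrating the reverse inequality
   would give [e |F| P(Y) <= 2 |E| <= e |F| P(Y) / 2]. *)
have d0 : 0 < e * P (~` B) / 4 by rewrite divr_gt0// mulr_gt0.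
have [F F0 leF] := amenable_folner (fset_set S) c_inj amG d0.
set E := leaving _ _ in leF.
pose U f := act f @^-1` ~` B.
pose V (p : G * G) := (act p.2 @^-1` ~` B) `&` (act (p.1 * p.2)%g @^-1` ~` B).
have mU f : measurable (U f) by exact: measurable_act_preimage.
have mV p : measurable (V p).
  by apply: measurableI; exact: measurable_act_preimage.
pose C0 := [set x | 2 * hits E V x < e * hits F U x].
have mC0 : measurable C0 by exact: measurable_lt_hits.
have PC0 : 0 < P C0.
  rewrite lt0r prob_ge0 andbT; apply/eqP => PC0.
  have : e * \sum_(f <- F) P (~` C0 `&` U f) <=
         2 * \sum_(p <- E) P (~` C0 `&` V p).
    apply: le_sum_prob => //; first exact: ltW.
      exact: measurableC.
    by move=> x /negP; rewrite -leNgt.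
  have lower : (#|` F|)%:R * P (~` B) <= \sum_(f <- F) P (~` C0 `&` U f).
    rewrite mulr_natl -iter_addr_0 -[#|` F|]count_predT -big_const_seq.
    apply: ler_sum => f _.
    have mCU : measurable (~` C0 `&` U f).
      by apply: measurableI => //; exact: measurableC.
    rewrite -(prob_act f mY) -[leRHS]addr0 -PC0.
    apply: le_trans (probU_le _ mCU mC0).
    apply: le_prob; [exact: mU|exact: measurableU|].
    move=> x Ux; case: (pselect (C0 x)) => Cx; [by right|by left].
  have upper : \sum_(p <- E) P (~` C0 `&` V p) <= (#|` E|)%:R.
    rewrite -[leRHS]mulr1 mulr_natl -iter_addr_0 -[#|` E|]count_predT -big_const_seq.
    apply: ler_sum => p _; apply: prob_le1.
    by apply: measurableI => //; exact: measurableC.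
  move=> /(le_trans (ler_wpM2l (ltW e0) lower)).
  move=> /le_trans /(_ (ler_wpM2l (ler0n R 2) upper)).
  apply/negP; rewrite -ltNge.
  apply: le_lt_trans (ler_wpM2l (ler0n R 2) leF) _.
  have : 0 < e * P (~` B) * (#|` F|)%:R.
    by rewrite !mulr_gt0// ltr0n cardfs_gt0.
  lra.
(* Avoiding translates by the quotients [g^-1 f] with [f <> g] is exactly the disjointness of the
   tiles. *)
pose K := [seq (p.2^-1 * p.1)%g | p <- (F `*` F)%fset & p.1 != p.2].
have K1 : 1%g \notin K.
  apply/negP => /mapP[[f g]]; rewrite mem_filter /= => /andP[fg _] E1.
  by move/eqP: fg; apply; rewrite -(mulg1 g) E1 mulVKg.
have [C [CC0 mC C_gt0 CK]] := disjoint_translates free K1 mC0 PC0.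
have C_disj f g x : f \in F -> g \in F -> C x -> C (act (g^-1 * f)%g x) -> f = g.
  move=> fF gF Cx Cgx; apply: contrapT => /eqP fg; apply: CK Cx Cgx.
  by apply/mapP; exists (f, g) => //; rewrite mem_filter /= fg in_fsetM fF.
have [Tu le_u lt_u] :=
  tiling_extend (ltW e0) T symS mC C_disj (fun x Cx => CC0 x Cx) C_gt0.
by eexists; [exact: Tu|split].
Qed.

Lemma tiling_empty (e : R) : is_tiling e ([set p | p.1 = p.2], set0).
Proof.
split=> //=.
- split=> [|[x y] /= ->|].
  + apply: (measurable_eq mA sepA); [exact: measurable_fst|exact: measurable_snd].
  + by exists 1%g; rewrite /= act_action.1.
  + by split=> // x y z /= -> ->.
- by move=> x; apply: (@sub_finite_set _ _ [set x]) => // y /= ->.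
- by left.
rewrite (_ : tiling_boundary_set _ = set0) ?prob0 ?mulr0//.
by apply/seteqP; split=> // x [s _ [[]]].
Qed.

(** * Exhaustion by tilings and decay of the profile *)

(* Ornstein-Weiss in the weak form needed here: by exhaustion, a tiling of
   maximal measure covers almost all of [X]. *)
Lemma amenable_finite_subequivalence (e : R) :
  symmetric_set S -> essentially_free mu act -> amenable R G -> 0 < e ->
  exists theta, [/\ subequivalence act theta,
    forall x, finite_set (rel_class theta x) &
    P (boundary act S theta) <= e].
Proof.
move=> symS free amG e0.
pose T := {t | is_tiling e t}.
have [|||||[[theta B] Tt] _ tmax] := @exists_maximal R T
    (fun t u => tiling_le (sval t) (sval u)) (fun t => P (sval t).2) 1
    _ _ _ _ _ (exist _ _ (tiling_empty e)).
- by move=> t; exact: tiling_le_refl.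
- by move=> t u v; exact: tiling_le_trans.
- move=> [t Tt] [u Tu] /= [tu _].
  by apply: le_prob => //; [exact: tiling_support Tt|exact: tiling_support Tu].
- by move=> [t Tt]; apply: prob_le1; exact: tiling_support Tt.
- move=> u u_inc.
  have [v Tv vP] := tiling_chain (ltW e0) (fun n => svalP (u n)) u_inc.
  by exists (exist _ v Tv).
have mB : measurable B := tiling_support Tt.
have [mt _ _] := tiling_subequivalence Tt.
have PB : P B = 1.
  apply: contrapT => /eqP PB1.
  have [|u Tu [tu lt_u]] := tiling_improve symS free amG e0 Tt.
    by rewrite lt_neqAle PB1 prob_le1.
  by have := tmax (exist _ u Tu) tu; rewrite leNgt lt_u.
exists theta; split; [exact: tiling_subequivalence Tt|exact: tiling_finite Tt|].
have mb := measurable_tiling_boundary (t := (theta, B)) mt mB.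
(* Boundary points in [B] are charged to the tiling; the others lie in the null complement of
   [B]. *)
apply: (@le_trans _ _ (P (tiling_boundary_set (theta, B) `|` ~` B))).
  apply: le_prob; first exact: measurable_boundary.
    by apply: measurableU => //; exact: measurableC.
  move=> x [s Ss xs]; case: (pselect (B x)) => Bx; last by right.
  by left; exists s => //; split=> //; left.
apply: le_trans (probU_le _ mb (measurableC mB)) _.
rewrite probC// PB subrr addr0; apply: le_trans (tiling_boundary Tt) _.
by rewrite PB mulr1.
Qed.

Lemma isoperimetric_profile_cvg :
  symmetric_set S -> essentially_free mu act -> amenable R G ->
  isoperimetric_profile mu act S n @[n --> \oo] --> 0%E.
Proof.
move=> symS free amG.
have profile_ge0 n : (0 <= isoperimetric_profile mu act S n)%E.
  by apply: le_ereal_inf_tmp => _ [theta _ <-].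
have small (e : R) : 0 < e -> \forall n \near \oo,
    (isoperimetric_profile mu act S n <= e%:E)%E.
  move=> e0; have e2 : 0 < e / 2 by rewrite divr_gt0.
  have [theta [st ft le1]] := amenable_finite_subequivalence symS free amG e2.
  have [m [theta' [st' tm le2]]] := bounded_subequivalence st ft e2.
  (* One relation with classes of size at most [m] bounds the profile at every [n >= m]. *)
  exists m => // n /= mn; apply: (@le_trans _ _ (mu (boundary act S theta'))).
    apply: ereal_inf_lbound; exists theta' => //; split=> // x.
    by apply: card_le_trans (tm x) _; rewrite card_le_II.
  rewrite probE ?lee_fin; last by apply: measurable_boundary; case: st'.
  by apply: le_trans le2 _; rewrite [leRHS]splitr lerD2r.
(* The profile is infinite at [n = 0], so its finiteness is claimed only eventually. *)
apply/fine_cvgP; split.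
  have := small 1 ltr01; apply: filterS => n n1.
  by rewrite ge0_fin_numE// (le_lt_trans n1)// ltry.
apply/cvgr0Pnorm_le => e e0; have := small e e0; apply: filterS => n ne /=.
rewrite ger0_norm ?fine_ge0// -lee_fin fineK//.
by rewrite ge0_fin_numE// (le_lt_trans ne)// ltry.
Qed.

End action.

Theorem theorem1p3 (R : realType) (G : groupType) (S : set G)
    (d : measure_display) (X : measurableType d) (mu : probability X R)
    (act : G -> X -> X) :
  finite_set S -> symmetric_set S -> generates S ->
  standard_borel R X ->
  is_group_action act -> measure_preserving mu act ->
  essentially_free mu act ->
  (isoperimetric_profile mu act S n @[n --> \oo] --> 0%E -> amenable R G) /\
  (amenable R G -> ergodic mu act ->
   isoperimetric_profile mu act S n @[n --> \oo] --> 0%E).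
Proof.
move=> finS symS genS /standard_borel_separating[A mA sepA] actA actmp free.
have [c c_inj] := finitely_generated_countable finS symS genS.
have cG : countable [set: G] by apply/countable_injP; exists c => g h _ _ /c_inj.
split=> [|amG _].
  exact: (amenable_of_isoperimetric_profile cG mA sepA).
exact: (isoperimetric_profile_cvg finS cG mA sepA).
Qed.
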